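(* Let $T>0$ and let $\lambda\in C^1([0,+\infty);(0,+\infty))$ (extended to $\mathbb{R}$ as described in the context). If $\rho_0\in L^1(0,1)$ and $u\in L^1(0,T)$ are nonnegative almost everywhere, then the Cauchy problem $$\partial_t\rho(t,x)+\partial_x\big(\lambda(W(t))\,\rho(t,x)\big)=0,\qquad W(t)=\int_0^1\rho(t,x)\,dx,\qquad (t,x)\in[0,T]\times[0,1],$$ $$\rho(0,x)=\rho_0(x)\ \ (0\le x\le 1),\qquad \rho(t,0)\,\lambda(W(t))=u(t)\ \ (0\le t\le T),$$ admits a unique weak solution $\rho\in C^0([0,T];L^1(0,1))$, and this solution is also nonnegative almost everywhere in $Q=[0,T]\times[0,1]$.
   Context: The function $\lambda\in C^1([0,+\infty);(0,+\infty))$ is fixed throughout and is extended to all of $\mathbb{R}$ in such a way that the extension, still denoted $\lambda$, lies in $C^1(\mathbb{R};(0,+\infty))$. Weak solution: let $T>0$, $\rho_0\in L^1(0,1)$ and $u\in L^1(0,T)$ be given. A weak solution of the Cauchy problem is a function $\rho\in C^0([0,T];L^1(0,1))$ such that, with $W(t)=\int_0^1\rho(t,x)\,dx$, for every $\tau\in[0,T]$ and every $\varphi\in C^1([0,\tau]\times[0,1])$ satisfying $\varphi(\tau,x)=0$ for all $x\in[0,1]$ and $\varphi(t,1)=0$ for all $t\in[0,\tau]$, one has $$\int_0^{\tau}\int_0^1\rho(t,x)\big(\varphi_t(t,x)+\lambda(W(t))\varphi_x(t,x)\big)\,dx\,dt+\int_0^{\tau}u(t)\varphi(t,0)\,dt+\int_0^1\rho_0(x)\varphi(0,x)\,dx=0.$$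 *)

(* Defs.v *)
From HB Require Import structures.
From mathcomp Require Import all_boot all_order all_algebra.
From mathcomp Require Import all_classical all_reals all_analysis.
Set Implicit Arguments.
Unset Strict Implicit.
Unset Printing Implicit Defensive.
Import Order.TTheory GRing.Theory Num.Theory.
Import numFieldNormedType.Exports.
Local Open Scope classical_set_scope.
Local Open Scope ring_scope.

(* Elements of L^1(a,b) are represented by functions R -> R integrable on
   ]a,b[; values outside ]a,b[ are irrelevant, and equality in L^1(a,b) is
   equality a.e. on ]a,b[. *)
Definition in_L1 (R : realType) (a b : R) (f : R -> R) : Prop :=
  lebesgue_measure.-integrable `]a, b[ (EFin \o f).

Definition ae_nonneg (R : realType) (a b : R) (f : R -> R) : Prop :=
  {ae lebesgue_measure, forall x, x \in `]a, b[ -> 0 <= f x}.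

(* lam is the extension to R, i.e. an element of C^1(R; (0,+oo)). *)
Definition C1_positive (R : realType) (lam : R -> R) : Prop :=
  [/\ forall w, derivable lam w 1,
      continuous (derive1 lam) &
      forall w, 0 < lam w].

Definition in_C0L1 (R : realType) (T : R) (rho : R -> R -> R) : Prop :=
  (forall t, t \in `[0, T] -> in_L1 0 1 (rho t)) /\
  (forall t, t \in `[0, T] ->
    \int[lebesgue_measure]_(x in `]0, 1[) `|rho s x - rho t x|
      @[s --> within `[0, T] (nbhs t)] --> (0 : R)).

Definition eq_C0L1 (R : realType) (T : R) (rho1 rho2 : R -> R -> R) : Prop :=
  forall t, t \in `[0, T] ->
    {ae lebesgue_measure, forall x, x \in `]0, 1[ -> rho1 t x = rho2 t x}.

Definition closed_rectangle (R : realType) (tau : R) : set (R * R) :=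
  `[0, tau] `*` `[0, 1].

Definition open_rectangle (R : realType) (tau : R) : set (R * R) :=
  `]0, tau[ `*` `]0, 1[.

(* C^1([0,tau] x [0,1]): phi is continuous on the closed rectangle,
   differentiable in its interior, and both partial derivatives extend
   continuously to the closed rectangle. *)
Definition C1_rectangle (R : realType) (tau : R) (phi : R * R -> R) : Prop :=
  [/\ {within closed_rectangle tau, continuous phi},
      forall z, open_rectangle tau z -> differentiable phi z &
      exists phit phix : R * R -> R,
        [/\ {within closed_rectangle tau, continuous phit},
            {within closed_rectangle tau, continuous phix} &
            forall z, open_rectangle tau z ->
              'D_(1, 0) phi z = phit z /\ 'D_(0, 1) phi z = phix z]].

Definition total_mass (R : realType) (rho : R -> R -> R) (t : R) : R :=
  \int[lebesgue_measure]_(x in `]0, 1[) rho t x.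

(* The derivatives of phi are only evaluated in the open rectangle, where
   'D_(1, 0) phi and 'D_(0, 1) phi are its genuine partial derivatives. *)
Definition weak_solution (R : realType) (T : R) (lam rho0 u : R -> R)
    (rho : R -> R -> R) : Prop :=
  in_C0L1 T rho /\
  forall (tau : R) (phi : R * R -> R),
    tau \in `[0, T] ->
    C1_rectangle tau phi ->
    (forall x, x \in `[0, 1] -> phi (tau, x) = 0) ->
    (forall t, t \in `[0, tau] -> phi (t, 1) = 0) ->
    \int[lebesgue_measure]_(t in `]0, tau[)
       (\int[lebesgue_measure]_(x in `]0, 1[)
          (rho t x * ('D_(1, 0) phi (t, x)
                      + lam (total_mass rho t) * 'D_(0, 1) phi (t, x))))
    + \int[lebesgue_measure]_(t in `]0, tau[) (u t * phi (t, 0))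
    + \int[lebesgue_measure]_(x in `]0, 1[) (rho0 x * phi (0, x)) = 0.

(* An element of C^0([0,T]; L^1(0,1)) is a function on Q = [0,T] x [0,1], up to
   null sets, through a representative that is jointly measurable; without that
   requirement, modifying rho t on a null set for each t could change rho on a
   set that is not Lebesgue-null in Q. *)
Definition ae_nonneg_on_Q (R : realType) (T : R) (rho : R -> R -> R) : Prop :=
  measurable_fun
    (closed_rectangle T : set (measurableTypeR R * measurableTypeR R))
    (fun z => rho z.1 z.2) /\
  {ae (lebesgue_measure \x lebesgue_measure)%E,
    forall z, closed_rectangle T z -> 0 <= rho z.1 z.2}.

(* Main.v *)
Require Import Defs.
From mathcomp Require Import all_boot all_order all_algebra.
From mathcomp Require Import all_classical all_reals all_analysis.
From mathcomp Require Import measurable_realfun ring lra.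
Set Implicit Arguments.
Unset Strict Implicit.
Unset Printing Implicit Defensive.
Import Order.TTheory GRing.Theory Num.Theory.
Import numFieldNormedType.Exports.
Local Open Scope classical_set_scope.
Local Open Scope ring_scope.

(** The equation transports mass to the right at a speed lam(W(t)) that does
not depend on x, so everything is governed by the displacement xi(t), the
integral of the speed over [0, t]. A particle carries a label z and sits at
xi(t) - z at time t: the initial mass at x has label - x, and the mass entering
at time s has label xi(s). The label distribution has density dens, and the
solution must be rho(t, x) = dens(xi(t) - x), called transported below. It is
nonnegative and depends continuously on t in L^1 because translations are
continuous in L^1 (translation_continuous).

Integrating in x, W(t) is the mass that has entered by time t minus the mass
whose label is at most xi(t) - 1 (transported_mass). Hence the speed solves
c(t) = lam(entered(t) - delayed(xi(t))), where delayed(z) only involves labels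
up to z - 1, that is, particles that entered strictly earlier. When delayed is a
given nondecreasing function a, this is the differential equation
xi' = lam(b - a(xi)). Since a is merely continuous, the right-hand side is not
Lipschitz in xi, but a monotonicity replaces this: for K = L / m, with m a lower
bound and L a Lipschitz constant of lam on the bounded range of possible masses
(truncated_speed), e^(K alpha) lam(b - alpha) is
nondecreasing in alpha and e^(- K alpha) lam(b - alpha) is nonincreasing. The
second fact gives uniqueness (ode_uniq); the first one makes the integral
operator of the equation order preserving, so that the largest subsolution is a
solution (ode_exists). The delay of one unit then gives existence and uniqueness
of the self-consistent speed by induction on integer labels
(self_consistent_exists, self_consistent_uniq), without any smallness of T.

It remains to link this with weak solutions. For a given speed c the function
transported c satisfies the weak formulation with lam(W) replaced by c: after
x = xi(t) - z and an exchange of integrals, the fundamental theorem of calculus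
along each particle path leaves only the value of the test function at the
entrance point (transported_weak). Conversely, two functions of
C^0([0, T]; L^1(0, 1)) with the same weak integrals for c are equal
(linear_uniq). If rho' is any weak solution and c' = lam(W'), both facts show
rho' = transported c'; computing the mass shows that c' is self-consistent,
hence is the unique self-consistent speed (weak_solution_transported). *)

(** * Displacements and entrance times *)

Section calculus.
Context {R : realType}.
Notation mu := (@lebesgue_measure R).
Implicit Types (c f g : R -> R) (t z : R).

(** The integral of c from 0 to t, for both signs of t, when c is constant on
the negative axis; with negative times available the displacement is a bijection
of the line, and labels need no case distinction. *)
Definition prim c t : R := \int[mu]_(s in `[0, t]) (c s - c 0) + c 0 * t.

Lemma prim0 c : prim c 0 = 0.
Proof. by rewrite /prim set_itv1 Rintegral_set1 mulr0 addr0. Qed.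

Lemma is_derive_continuous f (df x : R) : is_derive x 1 f df -> {for x, continuous f}.
Proof. by move=> [+ _] => /derivable1_diffP/differentiable_continuous. Qed.

Lemma continuous_integrable c (a b : R) : continuous c ->
  mu.-integrable `[a, b] (EFin \o c).
Proof.
move=> cc; apply: continuous_compact_integrable; first exact: segment_compact.
exact: continuous_subspaceT.
Qed.

(** Up to the linear term, prim is an integral from any a <= 0, because
c s - c 0 vanishes for s <= 0; a below t puts t in the interior. *)
Lemma is_derive_prim c t : continuous c -> (forall s, s <= 0 -> c s = c 0) ->
  is_derive t 1 (prim c) (c t).
Proof.
move=> cc c0; pose d s := c s - c 0.
pose a := Num.min t 0 - 1.
have a0 : a <= 0 by have : Num.min t 0 <= 0 by [rewrite ge_min lexx orbT]; rewrite /a; lra.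
have at_ : a < t by have : Num.min t 0 <= t by [rewrite ge_min lexx]; rewrite /a; lra.
have cd : continuous d by move=> x; apply: cvgB; [exact: cc|exact: cvg_cst].
have E : prim c = (fun y => \int[mu]_(s in `[a, y]) d s) + (fun y => c 0 * y).
  apply/funext => y; rewrite /prim fctE/=; congr (_ + _).
  rewrite Rintegral_mkcond [RHS]Rintegral_mkcond; apply: eq_Rintegral => s _.
  rewrite !patchE !mem_setE !in_itv/=.
  have [s0|s0] := ltP s 0; last by rewrite (le_trans a0 s0).
  by rewrite /d (c0 s (ltW s0)) subrr !if_same.
have tt1 : t < t + 1 by rewrite ltrDl.
rewrite E; have [|dF F'] := @continuous_FTC1 _ d (BLeft a) t (t + 1) tt1
  (continuous_integrable a (t + 1) cd) _ (cd t).
  by rewrite (@lte_fin R).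
have -> : c t = d t + c 0 by rewrite /d subrK.
apply: is_deriveD.
  by split; [exact: dF|rewrite -derive1E; exact: F'].
have -> : (fun y => c 0 * y) = c 0 *: (id : R -> R) by apply/funext => y.
by apply: is_derive_eq; rewrite [LHS]mulr1.
Qed.

Lemma is_derive_lb f (df : R -> R) m x y :
  (forall z, z \in `]x, y[ -> is_derive z 1 f (df z)) ->
  {within `[x, y], continuous f} ->
  (forall z, z \in `[x, y] -> m <= df z) -> x <= y -> m * (y - x) <= f y - f x.
Proof.
move=> fdf cf mdf xy; have [z zxy ->] := MVT_segment xy fdf cf.
by apply: ler_wpM2r; [rewrite subr_ge0|exact: mdf].
Qed.

Lemma is_derive_ub f (df : R -> R) m x y :
  (forall z, z \in `]x, y[ -> is_derive z 1 f (df z)) ->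
  {within `[x, y], continuous f} ->
  (forall z, z \in `[x, y] -> df z <= m) -> x <= y -> f y - f x <= m * (y - x).
Proof.
move=> fdf cf mdf xy; have [z zxy ->] := MVT_segment xy fdf cf.
by apply: ler_wpM2r; [rewrite subr_ge0|exact: mdf].
Qed.

(** The lower bound is uniform, so that prim c is a C^1 bijection of the line
with C^1 inverse. *)
Definition positive_rate c := [/\ continuous c,
  exists2 m, 0 < m & forall t, m <= c t & forall t, t <= 0 -> c t = c 0].

Lemma rate_derive c t : positive_rate c -> is_derive t 1 (prim c) (c t).
Proof. by case=> cc _ c0; exact: is_derive_prim. Qed.

Lemma prim_continuous c : positive_rate c -> continuous (prim c).
Proof. by move=> ec t; exact: is_derive_continuous (rate_derive t ec). Qed.

Lemma prim_lb c m x y : positive_rate c -> (forall t, m <= c t) -> x <= y ->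
  m * (y - x) <= prim c y - prim c x.
Proof.
move=> ec mc; apply: is_derive_lb => [z _||z _]; [exact: rate_derive| |exact: mc].
exact/continuous_subspaceT/prim_continuous.
Qed.

Lemma prim_ub c m x y : positive_rate c -> (forall t, c t <= m) -> x <= y ->
  prim c y - prim c x <= m * (y - x).
Proof.
move=> ec mc; apply: is_derive_ub => [z _||z _]; [exact: rate_derive| |exact: mc].
exact/continuous_subspaceT/prim_continuous.
Qed.

Lemma prim_mono c : positive_rate c -> {mono prim c : x y / x <= y}.
Proof.
move=> ec; have [_ [m m0 mc] _] := ec; apply: le_mono => x y xy.
have := prim_lb ec mc (ltW xy).
have : 0 < m * (y - x) by rewrite mulr_gt0// subr_gt0.
lra.
Qed.

Lemma prim_mono_lt c : positive_rate c -> {mono prim c : x y / x < y}.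
Proof. by move=> ec; exact/leW_mono/prim_mono. Qed.

Lemma prim_inj c : positive_rate c -> injective (prim c).
Proof.
move=> ec x y /eqP; rewrite eq_le !(prim_mono ec) => xy.
by apply/eqP; rewrite eq_le.
Qed.

(** The time at which the particle with label z enters at x = 0. *)
Definition prim_inv c z : R := xget 0 [set t | prim c t = z].

Lemma prim_invK c : positive_rate c -> cancel (prim_inv c) (prim c).
Proof.
move=> ec z; rewrite /prim_inv; case: xgetP => [t _ -> //|].
have [_ [m m0 mc] _] := ec.
(* the lower bound m on the slope gives prim c (- A) <= z <= prim c A *)
pose A := `|z| / m; have A0 : 0 <= A by rewrite divr_ge0// ltW.
have mA : m * A = `|z| by rewrite /A mulrC divfK// gt_eqF.
have pA : `|z| <= prim c A.
  by have := prim_lb ec mc A0; rewrite prim0 !subr0 mA.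
have pNA : prim c (- A) <= - `|z|.
  have := prim_lb ec mc (_ : - A <= 0); rewrite prim0 oppr_le0 opprK add0r sub0r mA.
  by move=> /(_ A0); lra.
have NAA : - A <= A by lra.
have [||t _ <-] := @IVT _ (prim c) (- A) A z NAA.
- exact/continuous_subspaceT/prim_continuous.
- have := ler_norm z; have := ler_norm (- z); rewrite normrN => h1 h2.
  by rewrite ge_min le_max; apply/andP; split; apply/orP; [left|right]; lra.
by move=> /(_ t) [].
Qed.

Lemma primK c : positive_rate c -> cancel (prim c) (prim_inv c).
Proof. by move=> ec t; apply: (prim_inj ec); rewrite prim_invK. Qed.

Lemma prim_inv_mono c : positive_rate c -> {mono prim_inv c : x y / x <= y}.
Proof. by move=> ec x y; rewrite -(prim_mono ec) !prim_invK. Qed.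

Lemma prim_inv_mono_lt c : positive_rate c -> {mono prim_inv c : x y / x < y}.
Proof. by move=> ec; exact/leW_mono/prim_inv_mono. Qed.

Lemma prim_inv0 c : positive_rate c -> prim_inv c 0 = 0.
Proof. by move=> ec; rewrite -[X in prim_inv _ X](prim0 c) primK. Qed.

Lemma prim_inv_lt c t z : positive_rate c -> (prim_inv c z < t) = (z < prim c t).
Proof. by move=> ec; rewrite -(prim_mono_lt ec) prim_invK. Qed.

Lemma prim_inv_gt c t z : positive_rate c -> (t < prim_inv c z) = (prim c t < z).
Proof. by move=> ec; rewrite -(prim_mono_lt ec) prim_invK. Qed.

Lemma prim_inv_le c t z : positive_rate c -> (prim_inv c z <= t) = (z <= prim c t).
Proof. by move=> ec; rewrite -(prim_mono ec) prim_invK. Qed.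

Lemma prim_inv_ge c t z : positive_rate c -> (t <= prim_inv c z) = (prim c t <= z).
Proof. by move=> ec; rewrite -(prim_mono ec) prim_invK. Qed.

Lemma is_derive_prim_inv c z : positive_rate c ->
  is_derive z 1 (prim_inv c) (c (prim_inv c z))^-1.
Proof.
move=> ec; rewrite -{1}(prim_invK ec z).
have [_ [m m0 mc] _] := ec.
apply: (@is_derive_inverse _ (prim c)).
- by near=> t; exact: primK.
- by near=> t; exact: prim_continuous.
- exact: rate_derive.
- by rewrite gt_eqF// (lt_le_trans m0).
Unshelve. all: by end_near. Qed.

Lemma prim_inv_continuous c : positive_rate c -> continuous (prim_inv c).
Proof. by move=> ec z; exact: is_derive_continuous (is_derive_prim_inv z ec). Qed.

End calculus.

(** * The displacement equation with a monotone delayed mass *)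

Section clamping.

(** Composing with a retraction turns continuity within a set into genuine
continuity; this is used for clamping to intervals and to rectangles. *)
Lemma continuous_comp_within (X Y Z : topologicalType) (A : set Y)
    (f : Y -> Z) (g : X -> Y) : continuous g -> (forall x, A (g x)) ->
  {within A, continuous f} -> continuous (f \o g).
Proof.
move=> cg gA cf x U /= nU; have := cf (g x) U nU.
rewrite /= /nbhs/= /nbhs_subspace/= mem_set//= => nA.
change (nbhs x [set y | U (f (g y))]).
have H : nbhs x [set y | A (g y) -> U (f (g y))] := cg x _ nA.
by apply: filterS H => y /=; apply.
Qed.

Context {R : realType}.
Implicit Types (a b t : R).

Definition clamp a b t : R := Num.max a (Num.min t b).

Lemma clamp_continuous a b : continuous (clamp a b).
Proof.
move=> t; apply: (@continuous_max _ _ (cst a) (fun t => Num.min t b)).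
  exact: cvg_cst.
by apply: (@continuous_min _ _ id (cst b)); [exact: cvg_id|exact: cvg_cst].
Qed.

Lemma clamp_itv a b t : a <= b -> clamp a b t \in `[a, b].
Proof. by move=> ab; rewrite in_itv/= le_max lexx/= ge_max ab ge_min lexx orbT. Qed.

Lemma clamp_id a b t : t \in `[a, b] -> clamp a b t = t.
Proof. by rewrite in_itv/= => /andP[at_ tb]; rewrite /clamp min_l// max_r. Qed.

Lemma clamp_left a b t : a <= b -> t <= a -> clamp a b t = a.
Proof. by move=> ab ta; rewrite /clamp min_l ?max_l// (le_trans ta). Qed.

Lemma continuous_clamp a b f : a <= b -> {within `[a, b], continuous f} ->
  continuous (f \o clamp a b : R -> R).
Proof.
move=> ab; apply: continuous_comp_within; first exact: clamp_continuous.
by move=> t; exact: clamp_itv.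
Qed.

End clamping.

Section ode.
Context {R : realType}.
Notation mu := (@lebesgue_measure R).

Lemma prim_Rint (c : R -> R) t : continuous c -> 0 <= t ->
  prim c t = \int[mu]_(s in `[0, t]) c s.
Proof.
move=> cc t0; rewrite /prim RintegralB//; last 2 first.
- exact: continuous_integrable.
- by apply: (@continuous_integrable _ (cst (c 0))) => x; exact: cvg_cst.
rewrite Rintegral_cst//= lebesgue_measure_itv/= lte_fin.
have [_|t0'] := ltP 0 t; first by rewrite oppr0 adde0/= subrK.
by have -> : t = 0 by [lra]; rewrite /= !mulr0 subr0 addr0.
Qed.

Lemma eq_from_derive (f g : R -> R) (T : R) : continuous f -> continuous g -> f 0 = g 0 ->
  (forall t, t \in `]0, T[ -> exists2 d, is_derive t 1 f d & is_derive t 1 g d) ->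
  forall t, t \in `[0, T] -> f t = g t.
Proof.
move=> cf cg fg0 fg t /[!in_itv]/= /andP[t0 tT].
have D z : z \in `]0, t[ -> is_derive z 1 (f - g) ((fun=> 0) z).
  move=> /[!in_itv]/= /andP[z0 zt].
  have [|d fd gd] := fg z; first by rewrite in_itv/= z0 (lt_le_trans zt).
  by rewrite -(subrr d); exact: is_deriveB.
have cfg : {within `[0, t], continuous (f - g)}.
  by apply: continuous_subspaceT => z; apply: continuousB; [exact: cf|exact: cg].
have [z _] := MVT_segment t0 D cfg.
rewrite mul0r !fctE fg0; lra.
Qed.

Variables (T m M L A : R) (l a b : R -> R).
Hypotheses (T0 : 0 < T) (m0 : 0 < m) (L0 : 0 <= L).
Hypotheses (ml : forall w, m <= l w) (lM : forall w, l w <= M).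
Hypotheses (lL : forall w w', `|l w - l w'| <= L * `|w - w'|).
Hypotheses (cl : continuous l) (ca : continuous a) (cb : continuous b).
Hypotheses (a0 : forall z, z <= 0 -> a z = a 0) (a_ge0 : forall z, 0 <= a z).
Hypotheses (aA : forall z, a z <= A) (a_mono : {homo a : x y / x <= y}).

Let K := L / m.

Local Lemma K_ge0 : 0 <= K.
Proof. by rewrite divr_ge0// ltW. Qed.

Local Lemma mulKm : K * m = L.
Proof. by rewrite /K divfK// gt_eqF. Qed.

(** Moving from x to y = x + d multiplies the weight by e^(K d) >= 1 + K d and
decreases l by at most L d = K m d <= K d l(w - y). *)
Lemma weight_incr (x y w : R) : x <= y ->
  expR (K * x) * l (w - x) <= expR (K * y) * l (w - y).
Proof.
move=> xy; have -> : y = x + (y - x) by lra.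
rewrite mulrDr expRD -mulrA ler_pM2l ?expR_gt0//.
set d := y - x; have d0 : 0 <= d by rewrite subr_ge0.
have h1 : l (w - x) - l (w - (x + d)) <= L * d.
  apply: (le_trans (ler_norm _)); apply: (le_trans (lL _ _)).
  by have -> : w - x - (w - (x + d)) = d by [lra]; rewrite ger0_norm.
have h2 : 1 + K * d <= expR (K * d) by exact: expR_ge1Dx.
have h3 : m <= l (w - (x + d)) by [].
have h4 : L * d <= K * d * l (w - (x + d)).
  by have := ler_wpM2l (mulr_ge0 K_ge0 d0) h3; rewrite -mulKm; lra.
apply: (@le_trans _ _ ((1 + K * d) * l (w - (x + d)))); first by lra.
by rewrite ler_pM2r// (lt_le_trans m0).
Qed.

(** The same balance, with the weight now absorbing an increase of l. *)
Lemma weight_decr (x y w : R) : x <= y ->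
  expR (- K * y) * l (w - y) <= expR (- K * x) * l (w - x).
Proof.
move=> xy; have -> : y = x + (y - x) by lra.
rewrite mulrDr expRD -mulrA ler_pM2l ?expR_gt0//.
set d := y - x; have d0 : 0 <= d by rewrite subr_ge0.
have h1 : l (w - (x + d)) - l (w - x) <= L * d.
  apply: (le_trans (ler_norm _)); apply: (le_trans (lL _ _)).
  by have -> : w - (x + d) - (w - x) = - d by [lra]; rewrite normrN ger0_norm.
have h2 : 1 + K * d <= expR (K * d) by exact: expR_ge1Dx.
have h3 : m <= l (w - x) by [].
have h4 : L * d <= K * d * l (w - x).
  by have := ler_wpM2l (mulr_ge0 K_ge0 d0) h3; rewrite -mulKm; lra.
rewrite mulNr expRN mulrC ler_pdivrMr ?expR_gt0// mulrC.
apply: (@le_trans _ _ ((1 + K * d) * l (w - x))); first by lra.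
by rewrite ler_pM2r// (lt_le_trans m0).
Qed.

Local Lemma e_cont (k : R) : continuous (fun z => expR (k * a z)).
Proof.
move=> z; apply: (@continuous_comp _ _ _ (fun z => k * a z) expR).
  by apply: cvgM; [exact: cvg_cst|exact: ca].
exact: continuous_expR.
Qed.

Lemma exp_rate (k : R) : positive_rate (fun z => expR (k * a z)).
Proof.
split; [exact: e_cont| |by move=> z z0; rewrite a0].
exists (expR (- (`|k| * A))) => [|t]; first exact: expR_gt0.
rewrite ler_expR; have := ler_norm (- (k * a t)); rewrite normrN normrM (ger0_norm (a_ge0 t)).
have := ler_wpM2l (normr_ge0 k) (aA t); lra.
Qed.

(** In the variable F(xi), where F' = e^(- K a), the equation reads
F(xi)' = e^(- K a(xi)) l(b - a(xi)), which is nonincreasing in xi as a is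
nondecreasing. Hence the squared difference of two solutions is nonincreasing,
and it vanishes at 0. *)
Lemma ode_uniq (c1 c2 : R -> R) (t0 : R) : positive_rate c1 -> positive_rate c2 ->
  (forall t, t \in `[0, t0] -> c1 t = l (b t - a (prim c1 t))) ->
  (forall t, t \in `[0, t0] -> c2 t = l (b t - a (prim c2 t))) ->
  forall t, t \in `[0, t0] -> prim c1 t = prim c2 t.
Proof.
move=> e1 e2 E1 E2 t /[!in_itv]/= /andP[t_ge0 tt0].
pose e z := expR (- K * a z); pose F := prim e.
have eF : positive_rate e by exact: exp_rate.
pose D (s : R) : R := F (prim c2 s) - F (prim c1 s).
pose dD (s : R) : R := e (prim c2 s) * c2 s - e (prim c1 s) * c1 s.
have isD (s : R) : is_derive s 1 D (dD s).
  apply: is_deriveB.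
  - have := rate_derive s e2; have := rate_derive (prim c2 s) eF => h1 h2.
    exact: is_derive1_comp.
  - have := rate_derive s e1; have := rate_derive (prim c1 s) eF => h1 h2.
    exact: is_derive1_comp.
pose D2 (s : R) : R := D s * D s.
have isD2 (s : R) : is_derive s 1 D2 (2 * (D s * dD s)).
  have -> : D2 = (D : R -> R) * (D : R -> R) by apply/funext.
  apply: (is_derive_eq (is_deriveM (isD s) (isD s))).
  by rewrite /GRing.scale/=; ring.
have : D2 t <= D2 0.
  apply: (@ler0_derive1_nincr _ D2 0 t) => //.
  - move=> s /[!in_itv]/= /andP[s0 st].
    have st0 : s \in `[0, t0] by rewrite in_itv/= !ltW// (lt_le_trans st).
    rewrite derive1E; have [_ h2] := isD2 s; rewrite [leLHS]h2.
    rewrite pmulr_rle0//.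
    rewrite /D /dD (E1 _ st0) (E2 _ st0).
    have [h|h] := leP (prim c1 s) (prim c2 s).
      rewrite mulr_ge0_le0// ?subr_ge0 ?(prim_mono eF)//.
      by rewrite subr_le0; exact/weight_decr/a_mono.
    rewrite mulr_le0_ge0// ?subr_le0 ?(prim_mono eF) ?(ltW h)//.
    by rewrite subr_ge0; exact/weight_decr/a_mono/ltW.
  - by apply: continuous_subspaceT => s; exact: is_derive_continuous (isD2 s).
have -> : D2 0 = 0 by rewrite /D2 /D !prim0 subrr mul0r.
rewrite /D2 -expr2 => D2le0.
have : D t ^+ 2 = 0 by apply/eqP; rewrite eq_le D2le0 sqr_ge0.
by move/eqP; rewrite sqrf_eq0 /D subr_eq0 => /eqP/(prim_inj eF) ->.
Qed.

(** In the variable E(xi), where E' = e^(K a), the equation becomes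
E(xi t) = Y xi t with Y order preserving in xi. The solution is the supremum of
the subsolutions S, as in the Knaster-Tarski theorem; they are taken
nondecreasing so that a o xi is measurable. *)
Let w (xi : R -> R) (s : R) : R := expR (K * a (xi s)) * l (b s - a (xi s)).
Let C := expR (K * A) * M.

Local Lemma w_ge0 xi s : 0 <= w xi s.
Proof. by rewrite mulr_ge0 ?expR_ge0// (le_trans (ltW m0)). Qed.

Local Lemma w_le xi s : w xi s <= C.
Proof.
rewrite /w /C ler_pM ?expR_ge0 ?lM// ?(le_trans (ltW m0))//.
by rewrite ler_expR ler_wpM2l// K_ge0.
Qed.

Local Lemma C_ge0 : 0 <= C.
Proof. by rewrite (le_trans (w_ge0 id 0))// w_le. Qed.

Local Lemma w_incr xi1 xi2 s : xi1 s <= xi2 s -> w xi1 s <= w xi2 s.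
Proof. by move=> h; exact/weight_incr/a_mono. Qed.

Local Lemma w_meas xi (D : set R) : measurable D -> nondecreasing_fun xi -> measurable_fun D (w xi).
Proof.
move=> mD nd.
have max : measurable_fun D (fun s => a (xi s)).
  by apply: nondecreasing_measurable => // x y xy; exact/a_mono/nd.
apply: measurable_funM.
  apply: (@measurableT_comp _ _ _ _ _ _ expR); first exact: measurable_expR.
  by apply: measurable_funM => //; exact: measurable_cst.
apply: (@measurableT_comp _ _ _ _ _ _ l); first exact: continuous_measurable_fun.
apply: measurable_funB => //.
by apply: measurable_funTS; exact: continuous_measurable_fun.
Qed.

Local Lemma w_int xi t : nondecreasing_fun xi -> mu.-integrable `[0, t] (EFin \o w xi).
Proof.
move=> nd; apply: measurable_bounded_integrable => //=.
- by rewrite lebesgue_measure_itv/=; case: ifP => _; rewrite ltry.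
- exact: w_meas.
- exists C; split; first exact: num_real.
  by move=> x Cx s _ /=; rewrite ger0_norm ?w_ge0// (le_trans (w_le _ _))// ltW.
Qed.

Let Y xi (t : R) : R := \int[mu]_(s in `[0, t]) w xi s.

Local Lemma Y_ge0 xi t : 0 <= Y xi t.
Proof. by apply: Rintegral_ge0 => s _; exact: w_ge0. Qed.

Local Lemma Y_incr xi1 xi2 t : nondecreasing_fun xi1 -> nondecreasing_fun xi2 ->
  (forall s, xi1 s <= xi2 s) -> Y xi1 t <= Y xi2 t.
Proof.
move=> n1 n2 h; apply: le_Rintegral => //; [exact: w_int|exact: w_int|].
by move=> s _; exact: w_incr.
Qed.

Local Lemma Y_le xi t : nondecreasing_fun xi -> 0 <= t -> Y xi t <= C * t.
Proof.
move=> n t0; have -> : C * t = \int[mu]_(s in `[0, t]) (cst C) s.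
  rewrite Rintegral_cst//= lebesgue_measure_itv/= lte_fin.
  have [_|t0'] := ltP 0 t; first by rewrite oppr0 adde0.
  by have -> : t = 0 by [lra]; rewrite /= !mulr0.
apply: le_Rintegral => //; first exact: w_int.
  by apply: (@continuous_integrable _ (cst C)) => x; exact: cvg_cst.
by move=> s _; exact: w_le.
Qed.

Local Lemma Y_neg xi t : t < 0 -> Y xi t = 0.
Proof. by move=> t0; rewrite /Y set_itv_ge ?Rintegral_set0// bnd_simp -ltNge. Qed.

Local Lemma Y_mono xi : nondecreasing_fun xi -> nondecreasing_fun (Y xi).
Proof.
move=> n s t st; have [s0|s0] := ltP s 0; first by rewrite Y_neg// Y_ge0.
have Yt : Y xi t - Y xi s = \int[mu]_(s in `]s, t]) w xi s.
  rewrite /Y; apply: (@Rintegral_itvB _ _ (BLeft 0) (BRight t)); first exact: w_int.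
  by rewrite bnd_simp. by rewrite bnd_simp.
rewrite -subr_ge0 Yt; apply: Rintegral_ge0 => r _; exact: w_ge0.
Qed.

Let E := prim (fun z => expR (K * a z)).
Let Ei := prim_inv (fun z => expR (K * a z)).
Let S := [set xi : R -> R | nondecreasing_fun xi /\ forall t, E (xi t) <= Y xi t].

Local Lemma E_rate : positive_rate (fun z => expR (K * a z)).
Proof. exact: exp_rate. Qed.

Local Lemma E_ge z : 0 <= z -> z <= E z.
Proof.
move=> z0; have := @prim_lb _ _ 1 0 z E_rate _ z0; rewrite prim0 !subr0 mul1r; apply.
by move=> t; rewrite -expR0 ler_expR mulr_ge0// K_ge0.
Qed.

Local Lemma S0 : S (cst 0).
Proof. by split => // t; rewrite /E prim0 Y_ge0. Qed.

Local Lemma S_ub xi t : S xi -> xi t <= C * Num.max 0 t.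
Proof.
move=> [nxi Exi]; have [x0|x0] := leP 0 (xi t); last first.
  by rewrite (le_trans (ltW x0))// mulr_ge0 ?C_ge0// le_max lexx.
apply: (le_trans (E_ge x0)); apply: (le_trans (Exi t)).
have [t0|t0] := ltP t 0; first by rewrite Y_neg// mulr_ge0 ?C_ge0// le_max lexx.
exact: Y_le.
Qed.

Let xi_sup (t : R) : R := sup [set xi t | xi in S].

Local Lemma xi_sup_ub xi t : S xi -> xi t <= xi_sup t.
Proof.
move=> Sxi; apply: ub_le_sup; last by exists xi.
by exists (C * Num.max 0 t) => _ [f Sf <-]; exact: S_ub.
Qed.

Local Lemma xi_sup_le t y : (forall xi, S xi -> xi t <= y) -> xi_sup t <= y.
Proof.
move=> h; apply: ge_sup; first by exists 0; exists (cst 0) => //; exact: S0.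
by move=> _ [f Sf <-]; exact: h.
Qed.

Local Lemma xi_sup_mono : nondecreasing_fun xi_sup.
Proof.
move=> s t st; apply: xi_sup_le => xi Sxi.
by apply: le_trans (xi_sup_ub t Sxi); case: Sxi => + _; exact.
Qed.

Local Lemma xi_sup_sub t : xi_sup t <= Ei (Y xi_sup t).
Proof.
apply: xi_sup_le => xi Sxi; rewrite /Ei prim_inv_ge; last exact: E_rate.
have [nxi Exi] := Sxi; apply: (le_trans (Exi t)).
by apply: Y_incr => //; [exact: xi_sup_mono|move=> s; exact: xi_sup_ub].
Qed.

(** The supremum is a subsolution since Y is order preserving; then Ei (Y xi_sup)
is a subsolution too, hence lies below the supremum. *)
Local Lemma xi_sup_fix t : E (xi_sup t) = Y xi_sup t.
Proof.
suff -> : xi_sup t = Ei (Y xi_sup t) by rewrite /E /Ei prim_invK//; exact: E_rate.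
apply/eqP; rewrite eq_le xi_sup_sub/=.
apply: (@xi_sup_ub (fun t => Ei (Y xi_sup t))); split.
  by move=> r s rs; rewrite /Ei prim_inv_mono ?Y_mono//; [exact: xi_sup_mono|exact: E_rate].
move=> s; rewrite /E /Ei prim_invK; last exact: E_rate.
apply: Y_incr; [exact: xi_sup_mono| |exact: xi_sup_sub].
by move=> r r' rs; rewrite /Ei prim_inv_mono ?Y_mono//; [exact: xi_sup_mono|exact: E_rate].
Qed.

Local Lemma xi_sup_cont : {within `[0, T], continuous xi_sup}.
Proof.
have -> : xi_sup = Ei \o Y xi_sup.
  by apply/funext => t /=; rewrite -xi_sup_fix /Ei /E primK//; exact: E_rate.
have cY : {within `[0, T], continuous (Y xi_sup)}.
  apply: parameterized_integral_continuous; first exact: ltW.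
  by apply: w_int; exact: xi_sup_mono.
apply: within_continuous_comp cY => x _.
by apply: prim_inv_continuous; exact: E_rate.
Qed.

(** The supremum only satisfies the integral equation for E(xi). On [0, T] it is
continuous, so the integrand is continuous, E(xi) is differentiable and the
chain rule for Ei gives xi' = l(b - a(xi)). Clamping time to [0, T] provides the
constant extension of the speed. *)
Lemma ode_exists : exists c : R -> R,
  [/\ continuous c, forall t, m <= c t <= M, forall t, c t = c (clamp 0 T t)
    & forall t, t \in `[0, T] -> c t = l (b t - a (prim c t))].
Proof.
pose k t := xi_sup (clamp 0 T t).
have ck : continuous k.
  by apply: continuous_clamp; [exact: ltW|exact: xi_sup_cont].
pose c t := l (b (clamp 0 T t) - a (k t)).
have cc : continuous c.
  move=> t; apply: (@continuous_comp _ _ _ (fun t => b (clamp 0 T t) - a (k t)) l).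
    apply: cvgB.
      apply: (@continuous_comp _ _ _ (clamp 0 T) b); first exact: clamp_continuous.
      exact: cb.
    by apply: (@continuous_comp _ _ _ k a); [exact: ck|exact: ca].
  exact: cl.
have clampK t : clamp 0 T (clamp 0 T t) = clamp 0 T t.
  by rewrite clamp_id// clamp_itv// ltW.
have cE t : c t = c (clamp 0 T t) by rewrite /c /k clampK.
have cm t : m <= c t <= M by rewrite /c ml lM.
have clow t : t <= 0 -> clamp 0 T t = clamp 0 T 0.
  by move=> t0; rewrite !clamp_left// ltW.
have ec : positive_rate c.
  split => //; first by exists m => // t; case/andP: (cm t).
  by move=> t t0; rewrite /c /k (clow t t0).
(* the integrand of Y at xi_sup, extended continuously beyond [0, T] *)
pose W t := expR (K * a (k t)) * c t.
have cW : continuous W.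
  move=> t; apply: cvgM; last exact: cc.
  by apply: (@continuous_comp _ _ _ k (fun z => expR (K * a z))); [exact: ck|exact: e_cont].
have eW : positive_rate W.
  split => //; last by move=> t t0; rewrite /W /c /k (clow t t0).
  exists m => // t; rewrite /W (le_trans (_ : m <= c t))//; first by case/andP: (cm t).
  rewrite ler_peMl ?(le_trans (ltW m0))//; first by case/andP: (cm t).
  by rewrite -expR0 ler_expR mulr_ge0// K_ge0.
pose f := Ei \o prim W.
have fxis t : t \in `[0, T] -> f t = xi_sup t.
  move=> tT; rewrite /f /=; have t0 : 0 <= t by move: tT; rewrite in_itv/= => /andP[].
  suff -> : prim W t = E (xi_sup t) by rewrite /Ei /E primK//; exact: E_rate.
  rewrite xi_sup_fix prim_Rint// /Y; apply: eq_Rintegral => s; rewrite inE/= in_itv/= => /andP[s0 st].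
  have sT : s \in `[0, T].
    by move: tT; rewrite !in_itv/= s0 => /andP[_ tT]; rewrite (le_trans st).
  by rewrite /W /w /c /k clamp_id.
have isf (t : R) : is_derive t 1 f (W t / expR (K * a (f t))).
  have h1 := rate_derive t eW; have h2 := is_derive_prim_inv (prim W t) E_rate.
  apply: (is_derive_eq (is_derive1_comp h2 h1)).
  by rewrite /f /Ei /= mulrC.
have fc : forall t, t \in `[0, T] -> f t = prim c t.
  apply: eq_from_derive.
  - by move=> t; exact: is_derive_continuous (isf t).
  - exact: prim_continuous.
  - by rewrite /f /= !prim0 /Ei prim_inv0//; exact: E_rate.
  move=> t tT; exists (c t); last exact: rate_derive.
  have tT' : t \in `[0, T] by apply: subset_itv_oo_cc tT.
  apply: (is_derive_eq (isf t)).
  rewrite fxis// /W {1}/k clamp_id// mulrAC divff ?mul1r// gt_eqF//.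
  exact: expR_gt0.
exists c; split => // t tT.
by rewrite {1}/c /k clamp_id// -fxis// fc.
Qed.

End ode.

(** * Self-consistent speeds *)

Section fixed_point.
Context {R : realType}.
Variables (T m M L : R) (l N U : R -> R).
Hypotheses (T0 : 0 < T) (m0 : 0 < m) (L0 : 0 <= L).
Hypotheses (ml : forall w, m <= l w) (lM : forall w, l w <= M).
Hypotheses (lL : forall w w', `|l w - l w'| <= L * `|w - w'|) (cl : continuous l).
Hypotheses (cN : continuous N) (N_mono : {homo N : x y / x <= y}).
Hypotheses (N_left : forall z, z <= -1 -> N z = 0) (N_right : forall z, 0 <= z -> N z = N 0).
Hypotheses (cU : continuous U) (U_mono : {homo U : x y / x <= y}).
Hypotheses (U_left : forall t, t <= 0 -> U t = 0) (U_right : forall t, T <= t -> U t = U T).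

(** N is the cumulative initial mass as a function of the label and U the
cumulative inflow as a function of time. At time t the particles beyond x = 1
are those with label at most prim c t - 1, so delayed c (prim c t) is the mass
that has left. *)
Definition entered (t : R) : R := N 0 + U t.
Definition mass_upto (c : R -> R) (z : R) : R := N z + U (prim_inv c z).
Definition delayed (c : R -> R) (z : R) : R := mass_upto c (z - 1).

Definition solves (a c : R -> R) :=
  forall t, t \in `[0, T] -> c t = l (entered t - a (prim c t)).

Local Lemma N_ge0 z : 0 <= N z.
Proof.
have [z1|z1] := leP z (-1); first by rewrite N_left.
by rewrite -(N_left (lexx (-1))) N_mono// ltW.
Qed.

Local Lemma N_le z : N z <= N 0.
Proof. by have [z0|z0] := leP z 0; [exact: N_mono|rewrite (N_right (ltW z0))]. Qed.

Local Lemma U_ge0 t : 0 <= U t.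
Proof.
have [z1|z1] := leP t 0; first by rewrite U_left.
by rewrite -(U_left (lexx 0)) U_mono// ltW.
Qed.

Local Lemma U_le t : U t <= U T.
Proof. by have [z0|z0] := leP t T; [exact: U_mono|rewrite (U_right (ltW z0))]. Qed.

Lemma entered_bounds t : 0 <= entered t <= N 0 + U T.
Proof. by rewrite addr_ge0 ?N_ge0 ?U_ge0//= lerD2l U_le. Qed.

Lemma mass_upto_bounds c z : 0 <= mass_upto c z <= N 0 + U T.
Proof. by rewrite addr_ge0 ?N_ge0 ?U_ge0//= lerD ?U_le ?N_le. Qed.

Lemma mass_upto_left c z : positive_rate c -> z <= 0 -> mass_upto c z = N z.
Proof.
by move=> ec z0; rewrite /mass_upto U_left ?addr0// -(prim_inv0 ec) prim_inv_mono.
Qed.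

Local Lemma entered_continuous : continuous entered.
Proof. by move=> t; apply: cvgD; [exact: cvg_cst|exact: cU]. Qed.

Local Lemma delayed_continuous c : positive_rate c -> continuous (delayed c).
Proof.
move=> ec z; have cs : {for z, continuous (fun y : R => y - 1)}.
  by apply: cvgB; [exact: cvg_id|exact: cvg_cst].
apply: cvgD; first by apply: (@continuous_comp _ _ _ (fun y : R => y - 1) N); [exact: cs|exact: cN].
apply: (@continuous_comp _ _ _ (fun y : R => y - 1) (fun z => U (prim_inv c z))); first exact: cs.
by apply: continuous_comp; [exact: prim_inv_continuous|exact: cU].
Qed.

Local Lemma delayed_left c z : positive_rate c -> z <= 0 -> delayed c z = delayed c 0.
Proof.
move=> ec z0.
suff h y : y <= 0 -> delayed c y = 0 by rewrite !h.
by move=> y0; rewrite /delayed mass_upto_left ?N_left//; lra.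
Qed.

Local Lemma delayed_mono c : positive_rate c -> {homo delayed c : x y / x <= y}.
Proof.
move=> ec x y xy; rewrite /delayed /mass_upto lerD// ?N_mono ?lerD2r//.
by rewrite U_mono// prim_inv_mono// lerD2r.
Qed.

Local Lemma delayed_ge0 c z : 0 <= delayed c z.
Proof. by case/andP: (mass_upto_bounds c (z - 1)). Qed.

Local Lemma delayed_le c z : delayed c z <= N 0 + U T.
Proof. by case/andP: (mass_upto_bounds c (z - 1)). Qed.

(** As long as prim d1 t <= z0 + 1, only labels up to z0 have left, so both
displacements solve the same equation up to time t. *)
Lemma delayed_agree c1 c2 d1 d2 z0 t : positive_rate c1 -> positive_rate c2 ->
  positive_rate d1 -> positive_rate d2 -> solves (delayed c1) d1 -> solves (delayed c2) d2 ->
  (forall z, z <= z0 -> mass_upto c1 z = mass_upto c2 z) ->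
  t \in `[0, T] -> prim d1 t <= z0 + 1 -> prim d1 t = prim d2 t.
Proof.
move=> ec1 ec2 ed1 ed2 S1 S2 h tT tz.
have [t0 tT'] : 0 <= t /\ t <= T by move: tT; rewrite in_itv/= => /andP.
have sub s : s \in `[0, t] -> s \in `[0, T].
  by rewrite !in_itv/= => /andP[-> st]/=; exact: le_trans tT'.
apply: (@ode_uniq _ m L (N 0 + U T) l (delayed c2) entered _ _ _ _ _ _ _ _ _ d1 d2 t) => //.
- exact: delayed_continuous.
- by move=> z z0'; exact: delayed_left.
- exact: delayed_ge0.
- exact: delayed_le.
- exact: delayed_mono.
- move=> s st; rewrite (S1 s (sub s st)) /delayed h//.
  rewrite lerBlDr (le_trans _ tz)// prim_mono//.
  by move: st; rewrite in_itv/= => /andP[].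
- by move=> s st; rewrite (S2 s (sub s st)).
- by rewrite in_itv/= t0 lexx.
Qed.

(** Agreement of the displacements up to the entrance of label z0 + 1 is
agreement of the entrance times of these labels: one unit of label is gained. A
label entering after T contributes U T, whatever its entrance time. *)
Lemma mass_upto_agree c1 c2 d1 d2 z0 : positive_rate c1 -> positive_rate c2 ->
  positive_rate d1 -> positive_rate d2 -> solves (delayed c1) d1 -> solves (delayed c2) d2 ->
  (forall z, z <= z0 -> mass_upto c1 z = mass_upto c2 z) ->
  forall z, z <= z0 + 1 -> mass_upto d1 z = mass_upto d2 z.
Proof.
move=> ec1 ec2 ed1 ed2 S1 S2 h z zz.
have [z_le0|z_gt0] := leP z 0; first by rewrite !mass_upto_left.
have th (d : R -> R) : positive_rate d -> 0 <= prim_inv d z.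
  by move=> ed; rewrite prim_inv_ge// prim0 ltW.
congr (_ + _).
have [t1|t1] := leP (prim_inv d1 z) T.
  rewrite -[X in prim_inv d2 X](prim_invK ed1 z).
  rewrite (delayed_agree ec1 ec2 ed1 ed2 S1 S2 h) ?primK//.
    by rewrite in_itv/= t1 th.
  by rewrite prim_invK.
have [t2|t2] := leP (prim_inv d2 z) T; last by rewrite !U_right// ltW.
have hs : forall z, z <= z0 -> mass_upto c2 z = mass_upto c1 z.
  by move=> y yz; rewrite h.
rewrite -[X in prim_inv d1 X](prim_invK ed2 z).
rewrite (delayed_agree ec2 ec1 ed2 ed1 S2 S1 hs) ?primK//.
  by rewrite in_itv/= t2 th.
by rewrite prim_invK.
Qed.

Definition self_consistent (c : R -> R) := solves (delayed c) c.

Local Lemma nat_above (x : R) : exists k : nat, x <= k%:R.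
Proof.
exists (Num.bound `|x|); apply: (le_trans (ler_norm x)).
by apply: ltW; exact: archi_boundP.
Qed.

(** Up to label 0 the mass is initial and does not depend on the speed; the
delay then propagates agreement from each integer label to the next. *)
Lemma self_consistent_uniq c1 c2 : positive_rate c1 -> positive_rate c2 ->
  self_consistent c1 -> self_consistent c2 ->
  forall t, t \in `[0, T] -> c1 t = c2 t.
Proof.
move=> e1 e2 S1 S2 t tT.
have h (k : nat) : forall z, z <= k%:R -> mass_upto c1 z = mass_upto c2 z.
  elim: k => [z z0|k IH z]; first by rewrite !mass_upto_left.
  by rewrite -natr1; exact: (mass_upto_agree e1 e2 e1 e2 S1 S2 IH).
have [k hk] := nat_above (prim c1 t).
have E : prim c1 t = prim c2 t.
  apply: (delayed_agree e1 e2 e1 e2 S1 S2 (h k) tT).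
  by rewrite (le_trans hk)// lerDl.
rewrite (S1 t tT) (S2 t tT) -E /delayed (h k)//.
by rewrite lerBlDr (le_trans hk)// lerDl.
Qed.

Let sp c := [/\ continuous c, forall t, m <= c t <= M
  & forall t, c t = c (clamp 0 T t)].

Local Lemma sp_rate c : sp c -> positive_rate c.
Proof.
case=> cc mM cE; split => //; first by exists m => // t; case/andP: (mM t).
by move=> t t0; rewrite cE [RHS]cE !clamp_left// ltW.
Qed.

(** Iterate the map sending a speed to the solution of the equation it delays.
Consecutive iterates f k, f k.+1 agree up to label k, and displacements on
[0, T] are at most M T, so any iterate with k >= M T is a fixed point. *)
Lemma self_consistent_exists : exists c : R -> R,
  [/\ continuous c, forall t, m <= c t <= M, forall t, c t = c (clamp 0 T t)
    & self_consistent c].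
Proof.
pose next c := xget (cst m) [set d | sp d /\ solves (delayed c) d].
have mM : m <= M by exact: le_trans (ml 0) (lM 0).
have spm : sp (cst m) by split => [x|x|x] //=; [exact: cvg_cst|rewrite lexx].
have nextP c : sp c -> sp (next c) /\ solves (delayed c) (next c).
  move=> /sp_rate ec; rewrite /next; case: xgetP => [d _ //|].
  have [d [cd dmM dE dS]] := @ode_exists _ T m M L (N 0 + U T) l (delayed c) entered
    T0 m0 L0 ml lM lL cl (delayed_continuous ec) entered_continuous
    (fun z => @delayed_left c z ec) (delayed_ge0 c) (delayed_le c) (delayed_mono ec).
  by move=> /(_ d) []; split.
pose f k := iter k next (cst m).
have spf k : sp (f k) by elim: k => [|k IH] //=; have [] := nextP _ IH.
have Sf k : solves (delayed (f k)) (f k.+1) by have [] := nextP _ (spf k).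
have ef k : positive_rate (f k) by exact: sp_rate.
have h (k : nat) : forall z, z <= k%:R -> mass_upto (f k) z = mass_upto (f k.+1) z.
  elim: k => [z z0|k IH z]; first by rewrite !mass_upto_left.
  by rewrite -natr1; exact: (mass_upto_agree (ef k) (ef k.+1) (ef k.+1) (ef k.+2) (Sf k) (Sf k.+1) IH).
have [k hk] := nat_above (M * T).
have [cc cmM cE] := spf k.+1.
exists (f k.+1); split => // t tT; rewrite (Sf k t tT) /delayed h//.
have [t0 tT'] : 0 <= t /\ t <= T by move: tT; rewrite in_itv/= => /andP.
have h1 := @prim_ub _ (f k.+1) M 0 t (ef _) (fun t => proj2 (andP (cmM t))) t0.
have M0 : 0 <= M by rewrite (le_trans (ltW m0)).
have h2 : M * t <= M * T by rewrite ler_wpM2l.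
move: h1; rewrite prim0 !subr0; lra.
Qed.

End fixed_point.

(** * Changes of variables for Lebesgue measure *)

Section measure_preserving.
Context {R : realType}.
Notation mu := (@lebesgue_measure R).
Local Open Scope ereal_scope.
Variable phi : R -> R.
Hypothesis mphi : measurable_fun [set: R] phi.
Hypothesis pres : forall X, ocitv X -> mu X = mu (phi @^-1` X).

(** Half-open intervals determine Lebesgue measure. *)
Lemma preserving A : measurable A -> mu A = mu (phi @^-1` A).
Proof. by move=> mA; apply: (@lebesgue_measure_unique _ (pushforward mu (phi : _ -> measurableTypeR R))) => //. Qed.

Lemma ge0_integral_preserving (f : R -> \bar R) : measurable_fun [set: R] f ->
  (forall x, 0 <= f x) -> \int[mu]_x f (phi x) = \int[mu]_x f x.
Proof.
move=> mf f0.
have <- := @ge0_integral_pushforward _ _ (measurableTypeR R) (measurableTypeR R) R phi mphi mu setT f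
  measurableT mf (fun x _ => f0 x).
by apply: eq_measure_integral => A mA _; rewrite [RHS]preserving.
Qed.

Lemma integrable_preserving (f : R -> \bar R) : mu.-integrable [set: R] f ->
  mu.-integrable [set: R] (f \o phi).
Proof.
move=> /integrableP[mf foo]; apply/integrableP; split.
  exact: measurableT_comp.
rewrite (@ge0_integral_preserving (fun x => `|f x|))//.
exact: measurableT_comp.
Qed.

Lemma integral_preserving (f : R -> \bar R) : mu.-integrable [set: R] f ->
  \int[mu]_x f (phi x) = \int[mu]_x f x.
Proof.
move=> fi; have /integrableP[mf _] := fi.
have <- := @integral_pushforward _ _ (measurableTypeR R) (measurableTypeR R) R phi mphi mu setT f
  mf (integrable_preserving fi) measurableT.
by apply: eq_measure_integral => A mA _; rewrite [RHS]preserving.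
Qed.

Lemma Rintegral_preserving (f : R -> R) : mu.-integrable [set: R] (EFin \o f) ->
  (\int[mu]_x f (phi x) = \int[mu]_x f x)%R.
Proof. by move=> fi; congr fine; exact: (integral_preserving fi). Qed.

End measure_preserving.

Lemma continuous_pair (X Y Z : topologicalType) (f : X -> Y) (g : X -> Z) :
  continuous f -> continuous g -> continuous (fun x => (f x, g x)).
Proof.
by move=> cf cg x; apply: (@cvg_pair _ _ _ _ (nbhs (f x)) (nbhs (g x))); [exact: cf|exact: cg].
Qed.

Lemma ge0_integral_mrestr d (X : measurableType d) (R : realType)
    (m : {measure set X -> \bar R}) (D : set X) (mD : measurable D) (f : X -> \bar R) :
  measurable_fun setT f -> (forall x, 0 <= f x)%E ->
  (\int[mrestr m mD]_x f x = \int[m]_(x in D) f x)%E.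
Proof.
move=> mf f0; rewrite -(setUv D) ge0_integral_setU//=; first last.
- by apply/disj_setPS => x [].
- by rewrite setUv.
- exact: measurableC.
rewrite [X in (_ + X)%E](_ : _ = 0%E) ?adde0.
  by apply: eq_measure_integral => A mA AD; rewrite /= /mrestr setIidl.
rewrite -(@integral_measure_zero _ X R (~` D) f).
apply: eq_measure_integral => A mA AD; rewrite /= /mrestr.
suff -> : A `&` D = set0 by rewrite measure0.
by apply/seteqP; split => x // [/AD].
Qed.

Section lebesgue_tools.
Context {R : realType}.
Notation mu := (@lebesgue_measure R).

Lemma reflect_measurable (a : R) : measurable_fun [set: R] (fun x => a - x).
Proof. by apply: measurable_funB => //; exact: measurable_cst. Qed.

Lemma reflect_preserving (a : R) X : ocitv X -> mu X = mu ((fun x => a - x) @^-1` X).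
Proof.
move=> [[x y] _ <-]/=.
have -> : (fun z => a - z) @^-1` `]x, y] = `[a - y, a - x[%classic.
  by apply/seteqP; split => z /=; rewrite !in_itv/= => /andP[h1 h2]; apply/andP; split; lra.
rewrite !lebesgue_measure_itv/= !lte_fin ltrD2l ltrN2.
by case: ifPn => // _; rewrite -!EFinD; congr EFin; lra.
Qed.

Lemma rate_gt0 (c : R -> R) t : positive_rate c -> 0 < c t.
Proof. by case=> _ [m m0 mc] _; exact: lt_le_trans (mc t). Qed.

Lemma rate_measurable (c : R -> R) (D : set R) : measurable D -> positive_rate c -> measurable_fun D c.
Proof. by move=> mD [cc _ _]; apply: measurable_funTS; exact: continuous_measurable_fun. Qed.

Lemma prim_inv_measurable (c : R -> R) : positive_rate c -> measurable_fun [set: R] (prim_inv c).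
Proof. by move=> ec; apply: continuous_measurable_fun; exact: prim_inv_continuous. Qed.

Lemma prim_measurable (c : R -> R) : positive_rate c -> measurable_fun [set: R] (prim c).
Proof. by move=> ec; apply: continuous_measurable_fun; exact: prim_continuous. Qed.

Lemma integral_rate (c : R -> R) (s t : R) : positive_rate c -> s < t ->
  (\int[mu]_(x in `[s, t]) (c x)%:E = (prim c t - prim c s)%:E)%E.
Proof.
move=> ec st; have cc : continuous c by case: ec.
rewrite (@continuous_FTC2 _ c (prim c))//.
- exact: continuous_subspaceT.
- split.
  + by move=> x _; have [] := rate_derive x ec.
  + by apply: cvg_at_right_filter; exact: prim_continuous.
  + by apply: cvg_at_left_filter; exact: prim_continuous.
- by move=> x _; rewrite derive1E; have [_ ->] := rate_derive x ec.
Qed.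

(** Lebesgue measure is the image under (s, y) |-> prim c s of planar Lebesgue
measure on the region 0 < y <= c s: the preimage of ]x, y] has area the integral
of c between the entrance times of x and y, which is y - x. Integrating against
this image measure is the substitution z = prim c s. *)
Section change_of_variables.
Local Open Scope ereal_scope.
Variable c : R -> R.
Hypothesis ec : positive_rate c.

Let D : set (measurableTypeR R * measurableTypeR R) := [set z | (0 < z.2) && (z.2 <= c z.1)]%R.

Local Lemma D_measurable : measurable D.
Proof.
have mb : measurable_fun [set: measurableTypeR R * measurableTypeR R]
    (fun z => (0 < z.2)%R && (z.2 <= c z.1)%R).
  apply: measurable_and.
    by apply: measurable_fun_ltr => //; exact: measurable_cst.
  apply: measurable_fun_ler => //.
  by apply: (@measurableT_comp _ _ _ _ _ _ c); [exact: rate_measurable|exact: measurable_fst].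
have := mb measurableT [set true] I; rewrite setTI.
by congr (measurable _); apply/seteqP; split => z /=.
Qed.

Let q (z : measurableTypeR R * measurableTypeR R) : measurableTypeR R := prim c z.1.

Local Lemma q_measurable : measurable_fun setT q.
Proof. by apply: (@measurableT_comp _ _ _ _ _ _ (prim c)); [exact: prim_measurable|exact: measurable_fst]. Qed.

Let nu : {measure set (measurableTypeR R) -> \bar R} :=
  measure_function_pushforward__canonical__measure_function_Measure (mrestr (mu \x mu) D_measurable) q_measurable.

Local Lemma slice (x k : R) : (0 <= k)%R ->
  \int[mu]_y (k%:E * (\1_D (x, y))%:E) = (k * c x)%:E.
Proof.
move=> k0.
have -> : (fun y => k%:E * (\1_D (x, y))%:E) = (fun y => k%:E * (\1_(`]0%R, c x]) y)%:E).
  apply/funext => y; rewrite !indicE.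
  suff -> : ((x, y) \in D) = (y \in `]0%R, c x]%classic) by [].
  by apply/idP/idP; rewrite !inE/= ?in_itv/=.
rewrite ge0_integralZl//=; last exact/measurable_EFinP/measurable_indic.
rewrite integral_indic//= setIT lebesgue_measure_itv/= lte_fin rate_gt0//.
by rewrite sube0 EFinM.
Qed.

Local Lemma nu_ocitv X : ocitv X -> mu X = nu X.
Proof.
move=> [[x y] _ <-]/=; rewrite /nu/= /pushforward /mrestr/=.
have mX : measurable (q @^-1` `]x, y]) by rewrite -[X in measurable X]setTI; exact: q_measurable.
rewrite -[X in _ = _ X]setIT -integral_indic//; last exact: measurableI D_measurable.
rewrite fubini_tonelli1//=; last first.
  by apply/measurable_EFinP/measurable_indic; exact: measurableI D_measurable.
have E s : \int[mu]_t (\1_(q @^-1` `]x, y] `&` D) (s, t))%:E =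
    (((fun s => (c s)%:E) \_ `]prim_inv c x, prim_inv c y]) s).
  rewrite patchE; case: ifPn => [|] h.
    have := @slice s 1 ler01; rewrite mul1r => <-; apply: eq_integral => t _.
    rewrite mul1e indicI/= [X in (X * _)%R]indicE mem_set ?mul1r//.
    by move: h; rewrite inE /q/= !in_itv/= prim_inv_lt ?prim_inv_ge// => /andP[-> ->].
  rewrite integral0_eq// => t _; rewrite indicI/= [X in (X * _)%R]indicE memNset ?mul0r//.
  move: h; rewrite notin_setE/= /q /= !in_itv/= => h.
  by apply: contra_not h; rewrite prim_inv_lt// prim_inv_ge// => /andP[-> ->].
rewrite /fubini_F/=; under eq_integral do rewrite E.
rewrite -integral_mkcond.
have [xy|yx] := ltP x y; last first.
  by rewrite !set_itv_ge ?measure0 ?integral_set0 ?bnd_simp -?leNgt ?prim_inv_mono.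
rewrite integral_itv_obnd_cbnd; last first.
  by apply/measurable_EFinP; apply: rate_measurable.
by rewrite integral_rate ?prim_inv_mono_lt// !prim_invK// lebesgue_measure_itv/= lte_fin xy.
Qed.

Lemma change_of_variables (f : R -> \bar R) : measurable_fun [set: R] f ->
  (forall x, 0 <= f x) ->
  \int[mu]_z f z = \int[mu]_s (f (prim c s) * (c s)%:E).
Proof.
move=> mf f0.
transitivity (\int[nu]_z f z).
  apply: eq_measure_integral => A mA _.
  by apply: (@lebesgue_measure_unique _ nu) => //; exact: nu_ocitv.
rewrite ge0_integral_pushforward//; last exact: q_measurable.
rewrite preimage_setT ge0_integral_mrestr//=; last exact: (measurableT_comp mf q_measurable).
rewrite integral_mkcond fubini_tonelli1/=; last 2 first.
- apply/(measurable_restrictT _ _).1; first exact: D_measurable.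
  by apply: measurable_funTS; exact: (measurableT_comp mf q_measurable).
- by move=> z; rewrite patchE; case: ifP.
apply: eq_integral => s _; rewrite /fubini_F/=.
have -> : (f (prim c s) * (c s)%:E = f (prim c s) * \int[mu]_y (1%:E * (\1_D (s, y))%:E)).
  by rewrite slice// mul1r.
rewrite -ge0_integralZl//=.
- apply: eq_integral => y _; rewrite patchE indicE; case: ifPn => _.
    by rewrite mul1e mule1.
  by rewrite !mule0.
- apply: emeasurable_funM => //; apply/measurable_EFinP.
  by apply: measurable_fun_pair2; apply: measurable_indic; exact: D_measurable.
Qed.

End change_of_variables.

(** For the product sigma-algebra: f is the limit of the functions obtained by
rounding the first coordinate down to multiples of 1/(n+1), each of which is, on
countably many strips, a continuous function of the second coordinate. *)
Lemma continuous_measurable2 (f : R * R -> R) : continuous f ->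
  measurable_fun [set: measurableTypeR R * measurableTypeR R] f.
Proof.
move=> cf.
(* 1/(n+1)-rounding; n.+1 avoids dividing by zero *)
pose rd (n : nat) (x : R) : R := (Num.floor (n.+1%:R * x))%:~R / n.+1%:R.
have rdx n x : `|x - rd n x| <= n.+1%:R^-1.
  rewrite /rd; have n0 : (0 : R) < n.+1%:R by [].
  have -> : x - (Num.floor (n.+1%:R * x))%:~R / n.+1%:R =
     (n.+1%:R * x - (Num.floor (n.+1%:R * x))%:~R) / n.+1%:R by field.
  rewrite normrM [X in _ * X]ger0_norm ?invr_ge0// ler_piMl ?invr_ge0//.
  have := Num.Theory.floor_le (n.+1%:R * x); have := Num.Theory.floorD1_gt (n.+1%:R * x).
  by rewrite intrD ler_norml; lra.
have crd x : rd n x @[n --> \oo] --> x.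
  apply/cvgrPdist_le => e e0; near=> n.
  apply: (le_trans (rdx n x)); apply: ltW; near: n; exact: (near_infty_natSinv_lt (PosNum e0)).
apply: (@measurable_fun_cvg _ _ _ _ (fun n z => f (rd n z.1, z.2))); last first.
  move=> [x y] _ /=; apply: (@cvg_comp _ _ _ (fun n => (rd n x, y)) f _ (nbhs (x, y))); last exact: cf.
  by apply: (@cvg_pair _ _ _ _ (nbhs x) (nbhs y)) => //=; exact: cvg_cst.
move=> n _ A mA; rewrite setTI.
have -> : (fun z => f (rd n z.1, z.2)) @^-1` A =
  \bigcup_(k : int) ([set x | Num.floor (n.+1%:R * x) = k] `*`
     ((fun y => f (k%:~R / n.+1%:R, y)) @^-1` A)).
  apply/seteqP; split => [[x y] /= h|[x y] [k _ [/= <- ]]] //.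
  by exists (Num.floor (n.+1%:R * x)).
apply: countable_bigcupT_measurable; first exact: countableP.
move=> k; apply: measurableX.
  have mfl : measurable_fun [set: R] (fun x : R => rd n x).
    apply: nondecreasing_measurable => // x y xy; rewrite /rd ler_pM2r ?invr_gt0//.
    by rewrite ler_int; apply: Num.Theory.le_floor; rewrite ler_pM2l.
  have -> : [set x | Num.floor (n.+1%:R * x) = k] = rd n @^-1` [set k%:~R / n.+1%:R].
    apply/seteqP; split => x /=; rewrite /rd; first by move=> ->.
    move/(congr1 (fun z => z * n.+1%:R)); rewrite !divfK//; exact: intr_inj.
  by rewrite -[X in measurable X]setTI; apply: mfl.
have cfk : continuous (fun y => f (k%:~R / n.+1%:R, y)).
  move=> y; apply: (@continuous_comp _ _ _ (fun y : R => (k%:~R / n.+1%:R : R, y)) f); last exact: cf.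
  by apply: continuous_pair; [exact: cst_continuous|move=> z; exact: cvg_id].
by rewrite -[X in measurable X]setTI; apply: (continuous_measurable_fun cfk).
Unshelve. all: by end_near. Qed.

End lebesgue_tools.

(** * The mass distribution over labels *)

Section integration_helpers.
Context {R : realType}.
Notation mu := (@lebesgue_measure R).
Implicit Types (f g : R -> R) (D : set R).

Lemma integrable_bdd D f g (M : R) : measurable D -> mu.-integrable D (EFin \o f) ->
  measurable_fun D g -> (forall x, D x -> `|g x| <= M) ->
  mu.-integrable D (EFin \o (fun x => f x * g x)).
Proof.
move=> mD fi mg gM.
have := @integrableMl _ _ _ mu D mD (EFin \o f) g fi mg; apply.
exists M; split; first exact: num_real.
by move=> x Mx y Dy /=; rewrite (le_trans (gM y Dy))// ltW.
Qed.

Lemma integrable_sub D f g : measurable D -> mu.-integrable D (EFin \o f) ->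
  mu.-integrable D (EFin \o g) -> mu.-integrable D (EFin \o (fun x => f x - g x)).
Proof.
move=> mD fi gi; have := @integrableB _ _ R mu D mD _ _ fi gi; exact: eq_integrable.
Qed.

Lemma integrable_add D f g : measurable D -> mu.-integrable D (EFin \o f) ->
  mu.-integrable D (EFin \o g) -> mu.-integrable D (EFin \o (fun x => f x + g x)).
Proof.
move=> mD fi gi; have := @integrableD _ _ R mu D mD _ _ fi gi; exact: eq_integrable.
Qed.

Lemma Rintegral_indic D f : \int[mu]_(x in D) f x = \int[mu]_x (f x * \1_D x).
Proof.
rewrite Rintegral_mkcond; apply: eq_Rintegral => x _.
by rewrite patchE indicE; case: ifP; rewrite (mulr1, mulr0).
Qed.

Lemma indic_le1 D x : `|\1_D x : R| <= 1.
Proof. by rewrite indicE; case: (_ \in _); rewrite (normr1, normr0). Qed.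

Lemma integrable_indic_mul D f : measurable D -> mu.-integrable [set: R] (EFin \o f) ->
  mu.-integrable [set: R] (EFin \o (fun x => f x * \1_D x)).
Proof.
move=> mD fi; apply: (@integrable_bdd _ _ _ 1) => //.
by move=> x _; exact: indic_le1.
Qed.

Lemma Rintegral_ae D f g : measurable D -> measurable_fun D f -> measurable_fun D g ->
  {ae mu, forall x, D x -> f x = g x} ->
  \int[mu]_(x in D) f x = \int[mu]_(x in D) g x.
Proof.
move=> mD mf mg fg; congr fine; apply: ae_eq_integral => //; [exact/measurable_EFinP..|].
move: fg; apply: filterS; first exact: (ae_filter_ringOfSetsType mu).
by move=> x h Dx; rewrite /= h.
Qed.

End integration_helpers.

Section cumulative.
Context {R : realType}.
Notation mu := (@lebesgue_measure R).
Variable f : R -> R.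
Hypotheses (f_int : mu.-integrable [set: R] (EFin \o f)) (f_ge0 : forall x, 0 <= f x).

Definition cdf (f : R -> R) t : R := \int[mu]_(x in `]-oo, t]) f x.

Local Lemma f_intS (D : set R) : measurable D -> mu.-integrable D (EFin \o f).
Proof. by move=> mD; apply: integrableS f_int. Qed.

Lemma cdfB s t : s <= t -> cdf f t - cdf f s = \int[mu]_(x in `]s, t]) f x.
Proof.
move=> st; apply: Rintegral_itvB; [exact: f_intS|by []|by rewrite bnd_simp].
Qed.

Lemma cdf_mono : {homo cdf f : x y / x <= y}.
Proof.
by move=> s t st; rewrite -subr_ge0 cdfB//; apply: Rintegral_ge0 => x _; exact: f_ge0.
Qed.

Lemma cdf_continuous : continuous (cdf f).
Proof.
move=> t; pose a := t - 1; pose b := t + 1.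
have ab : a < b by rewrite /a /b; lra.
have h : {within `[a, b], continuous (fun x => parameterized_integral mu a x f)}.
  by apply: parameterized_integral_continuous; [exact: ltW|exact: f_intS].
have [h1 _ _] := (continuous_within_itvP _ ab).1 h.
have tab : t \in `]a, b[ by rewrite in_itv/= /a /b; apply/andP; split; lra.
have E : \forall x \near t, cdf f a + parameterized_integral mu a x f = cdf f x.
  near=> x.
  have ax : a <= x by apply: ltW; near: x; apply: lt_nbhsr; rewrite /a; lra.
  rewrite /parameterized_integral -Rintegral_itv_obnd_cbnd; last exact: f_intS.
  by rewrite -cdfB// addrC subrK.
have hc : {for t, continuous (fun x => cdf f a + parameterized_integral mu a x f)}.
  by apply: cvgD; [exact: cvg_cst|exact: h1].
rewrite /continuous_at -(nbhs_singleton E).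
by apply: cvg_trans hc; exact: near_eq_cvg.
Unshelve. all: by end_near. Qed.

Lemma cdf_left a t : (forall x, x <= a -> f x = 0) -> t <= a -> cdf f t = 0.
Proof.
move=> f0 ta; rewrite /cdf -[RHS](mul0r (fine (mu `]-oo, t]))) -Rintegral_cst//.
apply: eq_Rintegral => x; rewrite inE/= in_itv/= => xt.
by rewrite f0// (le_trans xt).
Qed.

Lemma cdf_right a t : (forall x, a <= x -> f x = 0) -> a <= t -> cdf f t = cdf f a.
Proof.
move=> f0 ta; apply/eqP; rewrite -subr_eq0 cdfB//; apply/eqP.
rewrite -[RHS](mul0r (fine (mu `]a, t]))) -Rintegral_cst//.
apply: eq_Rintegral => x; rewrite inE/= in_itv/= => /andP[xt _].
by rewrite f0// ltW.
Qed.

End cumulative.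

Section transport.
Context {R : realType}.
Notation mu := (@lebesgue_measure R).
Variables r v : R -> R.
Hypotheses (r_int : mu.-integrable [set: R] (EFin \o r)) (r_ge0 : forall x, 0 <= r x).
Hypotheses (v_int : mu.-integrable [set: R] (EFin \o v)) (v_ge0 : forall x, 0 <= v x).

Let rN z := r (- z).

(** Density of the mass over labels: r is the initial density, at x = - z, and
the inflow v ds becomes v / c dz under z = prim c s. *)
Definition dens c z : R := r (- z) + v (prim_inv c z) / c (prim_inv c z).

Lemma r_measurable : measurable_fun [set: R] r.
Proof. by apply/measurable_EFinP; case/integrableP: r_int. Qed.

Lemma v_measurable : measurable_fun [set: R] v.
Proof. by apply/measurable_EFinP; case/integrableP: v_int. Qed.

Lemma opp_measurable : measurable_fun [set: R] (fun x : R => - x).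
Proof. by apply: measurable_funN; exact: measurable_id. Qed.

Lemma opp_preserving (X : set R) : ocitv X -> mu X = mu ((fun x : R => - x) @^-1` X).
Proof.
have -> : (fun x : R => - x) = (fun x => 0 - x) by apply/funext => x; rewrite sub0r.
exact: reflect_preserving.
Qed.

Lemma rN_int : mu.-integrable [set: R] (EFin \o rN).
Proof. exact: (integrable_preserving opp_measurable opp_preserving r_int). Qed.

Lemma dens_ge0 c z : positive_rate c -> 0 <= dens c z.
Proof. by move=> ec; rewrite addr_ge0 ?divr_ge0// ltW// rate_gt0. Qed.

Lemma dens_measurable c : positive_rate c -> measurable_fun [set: R] (dens c).
Proof.
move=> ec; apply: measurable_funD.
  by apply: measurableT_comp; [exact: r_measurable|exact: opp_measurable].
apply: measurable_funM.
  by apply: measurableT_comp; [exact: v_measurable|exact: prim_inv_measurable].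
apply: continuous_measurable_fun => x.
apply: cvgV; first by rewrite gt_eqF// rate_gt0.
apply: continuous_comp; first exact: prim_inv_continuous.
by case: ec => cc _ _; exact: cc.
Qed.

Section ge0.
Local Open Scope ereal_scope.

(** The reflection x = - z for the initial part, z = prim c s for the inflow. *)
Lemma ge0_dens_formula c (g : R -> R) : positive_rate c -> measurable_fun [set: R] g ->
  (forall z, 0 <= g z)%R ->
  \int[mu]_z (dens c z * g z)%:E =
  \int[mu]_x (r x * g (- x))%:E + \int[mu]_s (v s * g (prim c s))%:E.
Proof.
move=> ec mg g0.
have m1 : measurable_fun [set: R] (fun z => (r (- z) * g z)%:E).
  apply/measurable_EFinP; apply: measurable_funM => //.
  by apply: measurableT_comp; [exact: r_measurable|exact: opp_measurable].
have m2 : measurable_fun [set: R] (fun z => (v (prim_inv c z) / c (prim_inv c z) * g z)%:E).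
  apply/measurable_EFinP; apply: measurable_funM => //.
  have -> : (fun z => v (prim_inv c z) / c (prim_inv c z))%R = (fun z => dens c z - r (- z))%R.
    by apply/funext => z; rewrite /dens addrAC subrr add0r.
  apply: measurable_funB; first exact: dens_measurable.
  by apply: measurableT_comp; [exact: r_measurable|exact: opp_measurable].
rewrite /dens; under eq_integral do rewrite mulrDl EFinD.
rewrite ge0_integralD//; last 2 first.
- by move=> z _; rewrite lee_fin mulr_ge0.
- by move=> z _; rewrite lee_fin mulr_ge0// divr_ge0// ltW// rate_gt0.
congr (_ + _).
  rewrite -(ge0_integral_preserving opp_measurable opp_preserving m1); last first.
    by move=> x; rewrite lee_fin mulr_ge0.
  by apply: eq_integral => x _; rewrite opprK.
rewrite (change_of_variables ec m2); last first.
  by move=> x; rewrite lee_fin mulr_ge0// divr_ge0// ltW// rate_gt0.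
apply: eq_integral => s _; rewrite primK// -EFinM mulrAC divfK//.
by rewrite gt_eqF// rate_gt0.
Qed.

Lemma dens_int c : positive_rate c -> mu.-integrable [set: R] (EFin \o dens c).
Proof.
move=> ec; apply/integrableP; split; first by apply/measurable_EFinP; exact: dens_measurable.
have -> : \int[mu]_x `|(EFin \o dens c) x| = \int[mu]_z (dens c z * cst 1 z)%:E.
  by apply: eq_integral => z _; rewrite /= mulr1 ger0_norm// dens_ge0.
rewrite (@ge0_dens_formula c (cst 1%R) ec (measurable_cst _) (fun _ => ler01)).
have h f : mu.-integrable [set: R] (EFin \o f) -> (forall x, 0 <= f x)%R ->
    \int[mu]_x (f x * 1)%:E < +oo.
  move=> /integrableP[_ fi] f0; apply: le_lt_trans fi.
  by rewrite le_eqVlt; apply/orP; left; apply/eqP/eq_integral => x _; rewrite /= mulr1 ger0_norm.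
by rewrite lte_add_pinfty// h.
Qed.

End ge0.

(** The nonnegative formula applies to g + M and to M; subtract. *)
Lemma dens_formula c (g : R -> R) (M : R) : positive_rate c -> measurable_fun [set: R] g ->
  (forall z, `|g z| <= M) ->
  \int[mu]_z (dens c z * g z) =
  \int[mu]_x (r x * g (- x)) + \int[mu]_s (v s * g (prim c s)).
Proof.
move=> ec mg gM.
have M0 : 0 <= M by exact: le_trans (gM 0).
have mgN : measurable_fun [set: R] (fun x => g (- x)).
  by apply: measurableT_comp; [exact: mg|exact: opp_measurable].
have mgp : measurable_fun [set: R] (fun x => g (prim c x)).
  by apply: measurableT_comp; [exact: mg|exact: prim_measurable].
have dI := dens_int ec.
have E (f k : R -> R) : mu.-integrable [set: R] (EFin \o f) -> measurable_fun [set: R] k ->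
    (forall z, `|k z| <= M) ->
    \int[mu]_z (f z * (k z + M)) = \int[mu]_z (f z * k z) + \int[mu]_z (f z) * M.
  move=> fi mk kM; under eq_Rintegral do rewrite mulrDr.
  rewrite RintegralD//; first by rewrite RintegralZr.
    by apply: integrable_bdd => // x _; exact: kM.
  by apply: (@integrable_bdd _ _ _ (cst M) M) => // x _ /=; rewrite ger0_norm.
have F0 : \int[mu]_z (dens c z * (g z + M)) =
    \int[mu]_x (r x * (g (- x) + M)) + \int[mu]_s (v s * (g (prim c s) + M)).
  have I1 (k : R -> R) (f : R -> R) : mu.-integrable [set: R] (EFin \o f) -> measurable_fun [set: R] k ->
    (forall z, `|k z| <= M) -> (\int[mu]_z (f z * (k z + M))%:E)%E \is a fin_num.
    move=> fi mk kM; apply: integrable_fin_num => //.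
    apply: (@integrable_bdd _ _ _ (fun z => k z + M) (M + M)) => //.
      by apply: measurable_funD => //; exact: measurable_cst.
    by move=> z _; rewrite (le_trans (ler_normD _ _))// lerD// ger0_norm.
  rewrite /Rintegral -fineD; [|exact: I1|exact: I1].
  rewrite -(@ge0_dens_formula c (fun z => g z + M)) //.
  - by apply: measurable_funD => //; exact: measurable_cst.
  - by move=> z; have := gM z; rewrite ler_norml; lra.
have F1 : \int[mu]_z (dens c z) = \int[mu]_x (r x) + \int[mu]_s (v s).
  have I1 (f : R -> R) : mu.-integrable [set: R] (EFin \o f) ->
     (\int[mu]_z (f z)%:E)%E \is a fin_num by move=> fi; exact: integrable_fin_num.
  rewrite /Rintegral -fineD; [|exact: I1|exact: I1]; congr fine.
  have E1 (f : R -> R) : (\int[mu]_z (f z * 1)%:E = \int[mu]_z (f z)%:E)%E.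
    by apply: eq_integral => z _; rewrite mulr1.
  have := @ge0_dens_formula c (cst 1) ec (measurable_cst _) (fun _ => ler01).
  by rewrite /= !E1.
by move: F0; rewrite !E// F1 mulrDl [RHS]addrACA => /addIr.
Qed.

End transport.

(** * Continuity of translations in L^1 *)

Section translation.
Context {R : realType}.
Notation mu := (@lebesgue_measure R).
Implicit Types (f g : R -> R).

Lemma Rintegral_reflect (a : R) f : mu.-integrable [set: R] (EFin \o f) ->
  \int[mu]_x f (a - x) = \int[mu]_x f x.
Proof. by move=> fi; apply: (Rintegral_preserving (reflect_measurable a)) => //; exact: reflect_preserving. Qed.

Lemma integrable_reflect (a : R) f : mu.-integrable [set: R] (EFin \o f) ->
  mu.-integrable [set: R] (EFin \o (fun x => f (a - x))).
Proof. by move=> fi; apply: (integrable_preserving (reflect_measurable a) _ fi) => //; exact: reflect_preserving. Qed.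

Lemma integrable_setT_in f (D : set R) : measurable D ->
  mu.-integrable [set: R] (EFin \o f) -> mu.-integrable D (EFin \o f).
Proof. by move=> mD; apply: integrableS. Qed.

(** Translates by nearby amounts look at f through nearby windows b - D, all
inside one fixed window E. *)
Lemma window_le (b : R) f (D E : set R) : measurable D -> measurable E ->
  mu.-integrable [set: R] (EFin \o f) -> (forall z, 0 <= f z) ->
  (forall x, D x -> E (b - x)) ->
  \int[mu]_(x in D) f (b - x) <= \int[mu]_(z in E) f z.
Proof.
move=> mD mE fi f0 DE.
rewrite (Rintegral_indic D) (Rintegral_indic E) -(@Rintegral_reflect b (fun z => f z * \1_E z)); last exact: integrable_indic_mul.
apply: le_Rintegral => //.
- by apply: integrable_indic_mul => //; exact: integrable_reflect.
- by apply: (@integrable_reflect b (fun z => f z * \1_E z)); exact: integrable_indic_mul.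
move=> x _; apply: ler_wpM2l => //; rewrite !indicE.
have [/set_mem/DE/mem_set -> //|//] := boolP (x \in D).
Qed.

Lemma continuous_bounded_itv g (a b : R) : continuous g ->
  exists M : R, forall x, x \in `[a, b] -> `|g x| <= M.
Proof.
move=> cg; have [ab|ba] := leP a b; last first.
  by exists 0 => x /[!in_itv]/= /andP[h1 h2]; exfalso; lra.
have cn : {within `[a, b], continuous (fun x => `|g x|)}.
  apply: continuous_subspaceT => x; apply: continuous_comp; first exact: cg.
  exact: norm_continuous.
by have [c _ h] := EVT_max ab cn; exists `|g c|.
Qed.

(** Approximate f in L^1 by a continuous g on the interval [a - 2, a + 1], which
contains every b - x with b near a and x in ]0, 1[; for g, dominated convergence
applies, and the two errors f - g cost at most e / 3 each. *)
Lemma translation_continuous f (a : R) : mu.-integrable [set: R] (EFin \o f) ->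
  \int[mu]_(x in `]0, 1[) `|f (b - x) - f (a - x)| @[b --> a] --> 0.
Proof.
move=> fi; pose E : set R := `[a - 2, a + 1]%classic.
have mE : measurable E by exact: measurable_itv.
have Eoo : (mu E < +oo)%E.
  by rewrite /E /= lebesgue_measure_itv/=; case: ifP => _; rewrite ltry.
have fE : mu.-integrable E (EFin \o f) by exact: integrable_setT_in.
have [g_ [cg_ ig_ g_cvg]] := approximation_continuous_integrable mE Eoo fE.
apply/cvgrPdist_le => e e0.
have e3 : 0 < e / 3 by rewrite divr_gt0.
have [n gn] : exists n, \int[mu]_(z in E) `|f z - g_ n z| <= e / 3.
  move/fine_cvgP: g_cvg => [_ /cvgrPdist_le /(_ _ e3)[N _ /(_ N (leqnn N))]] /=.
  rewrite sub0r normrN => h; exists N; apply: le_trans h.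
  rewrite ger0_norm ?fine_ge0 ?integral_ge0//.
pose g := g_ n; have cg : continuous g by exact: cg_.
have [M gM] := continuous_bounded_itv (a - 2) (a + 1) cg.
have wE (b x : R) : b \in `]a - 1, a + 1[ -> x \in `]0, 1[ -> b - x \in `[a - 2, a + 1].
  by rewrite !in_itv/= => /andP[b1 b2] /andP[x1 x2]; apply/andP; split; lra.
have aI : a \in `]a - 1, a + 1[ by rewrite in_itv/=; apply/andP; split; lra.
have mshift (k : R -> R) (b : R) : measurable_fun [set: R] k -> measurable_fun [set: R] (fun x => k (b - x)).
  by move=> mk; apply: measurableT_comp => //; exact: reflect_measurable.
have mg : measurable_fun [set: R] g by exact: continuous_measurable_fun.
have mf : measurable_fun [set: R] f by apply/measurable_EFinP; case/integrableP: fi.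
have igb b : b \in `]a - 1, a + 1[ -> mu.-integrable `]0, 1[ (EFin \o (fun x => g (b - x))).
  move=> bI; apply: measurable_bounded_integrable => //=.
  - by rewrite lebesgue_measure_itv/= lte_fin ltr01 ltry.
  - by apply: measurable_funTS; exact: mshift.
  - exists M; split; first exact: num_real.
    by move=> y My x /= x01; rewrite (le_trans _ (ltW My))// gM// wE.
have ifb b : mu.-integrable `]0, 1[ (EFin \o (fun x => f (b - x))).
  by apply: integrable_setT_in => //; exact: integrable_reflect.
pose H b := \int[mu]_(x in `]0, 1[) `|g (b - x) - g (a - x)|.
have Ha : H a = 0.
  rewrite /H -[RHS](mul0r (fine (mu `]0, 1[))) -Rintegral_cst//.
  by apply: eq_Rintegral => x _; rewrite subrr normr0.
have cH : {for a, continuous H}.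
  suff h : {in (`]a - 1, a + 1[ : set R)%classic, continuous H} by apply: h; rewrite inE.
  apply: (@continuity_under_integral R _ (measurableTypeR R) mu (fun b x => `|g (b - x) - g (a - x)|)
    `]0, 1[%classic _ (a - 1) (a + 1) _ _ (cst (2 * M))) => //=.
  - move=> b bI; apply: integrable_norm => //.
    by apply: integrable_sub => //; exact: igb.
  - apply: aeW => x _ b _.
    apply: (@continuous_comp _ _ _ (fun b : R => g (b - x) - g (a - x)) (fun z : R => `|z|)); last exact: norm_continuous.
    apply: cvgB; last exact: cvg_cst.
    apply: (@continuous_comp _ _ _ (fun b : R => b - x) g); last exact: cg.
    by apply: cvgB; [exact: cvg_id|exact: cvg_cst].
  - apply: (@integrableS _ _ R mu `[0, 1]%classic) => //; first exact: subset_itv_oo_cc.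
    by apply: (@continuous_integrable _ (cst (2 * M))) => x; exact: cvg_cst.
  - move=> b bI; apply: aeW => x x01.
    rewrite /= normr_id (le_trans (ler_normB _ _))//.
    have := gM _ (wE _ _ bI x01); have := gM _ (wE _ _ aI x01); lra.
near=> b.
have bI : b \in `]a - 1, a + 1[.
  by near: b; apply: near_in_itvoo.
have hH : H b <= e / 3.
  near: b; move/cvgrPdist_le : cH => /(_ _ e3); rewrite Ha; apply: filterS => b.
  by rewrite sub0r normrN => h; rewrite (le_trans _ h)// ler_norm.
rewrite sub0r normrN ger0_norm; last by apply: Rintegral_ge0.
pose k z := `|f z - g z| * \1_E z.
have ik : mu.-integrable [set: R] (EFin \o k).
  have : mu.-integrable E (EFin \o (fun z => `|f z - g z|)).
    by apply: integrable_norm => //; apply: integrable_sub => //; exact: ig_.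
  move/(@integrable_mkcond _ _ R mu E _ mE); apply: eq_integrable => // z _.
  by rewrite /k patchE/= indicE; case: ifP; rewrite (mulr1, mulr0).
have kE : \int[mu]_(z in E) k z <= e / 3.
  apply: le_trans gn; rewrite le_eqVlt; apply/orP; left; apply/eqP.
  by apply: eq_Rintegral => z zE; rewrite /k indicE zE mulr1.
have k0 z : 0 <= k z by rewrite mulr_ge0// indicE.
have kw c' : c' \in `]a - 1, a + 1[ -> \int[mu]_(x in `]0, 1[) k (c' - x) <= e / 3.
  move=> cI; apply: le_trans kE; apply: window_le => // x x01.
  exact: wE.
have ikc c' : mu.-integrable `]0, 1[ (EFin \o (fun x => k (c' - x))).
  by apply: integrable_setT_in => //; exact: integrable_reflect.
have igg : mu.-integrable `]0, 1[ (EFin \o (fun x => `|g (b - x) - g (a - x)|)).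
  by apply: integrable_norm => //; apply: integrable_sub => //; exact: igb.
apply: (@le_trans _ _ (\int[mu]_(x in `]0, 1[) (k (b - x) + `|g (b - x) - g (a - x)| + k (a - x)))).
  apply: le_Rintegral => //.
  - by apply: integrable_norm => //; apply: integrable_sub => //; exact: ifb.
  - by apply: integrable_add => //; apply: integrable_add.
  move=> x x01; rewrite /k !indicE !mem_set ?mulr1; [|exact: wE|exact: wE].
  have -> : f (b - x) - f (a - x) = (f (b - x) - g (b - x)) + (g (b - x) - g (a - x)) - (f (a - x) - g (a - x)) by lra.
  by rewrite (le_trans (ler_normB _ _))// lerD2r ler_normD.
have i1 := integrable_add (measurable_itv `]0, 1[) (ikc b) igg.
rewrite (RintegralD _ i1 (ikc a)); last exact: measurable_itv.
rewrite (RintegralD _ (ikc b) igg); last exact: measurable_itv.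
have := kw _ aI; have := kw _ bI; move: hH; rewrite /H; lra.
Unshelve. all: by end_near. Qed.

End translation.

(** * The transported density *)

Section fubini_chain.
Context {R : realType}.
Notation mu := (@lebesgue_measure R).

Lemma dominated_integrable1 (f g : R -> R) (D : set R) : measurable D -> measurable_fun D f ->
  mu.-integrable D (EFin \o g) -> (forall x, D x -> `|f x| <= g x) ->
  mu.-integrable D (EFin \o f).
Proof.
move=> mD mf gi fg.
apply: (@le_integrable _ _ R mu D mD (EFin \o f) (EFin \o g)) => //.
  exact/measurable_EFinP.
move=> x Dx; rewrite /= lee_fin (le_trans (fg x Dx))//.
by rewrite ler_norm.
Qed.

Lemma Rfubini (f : R -> R -> R) (k l : R -> R) :
  measurable_fun [set: measurableTypeR R * measurableTypeR R] (fun z => f z.1 z.2) ->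
  mu.-integrable [set: R] (EFin \o k) -> mu.-integrable [set: R] (EFin \o l) ->
  (forall t z, `|f t z| <= k t * l z) ->
  \int[mu]_t \int[mu]_z f t z = \int[mu]_z \int[mu]_t f t z.
Proof.
move=> mf ki li fkl.
have i1 t : mu.-integrable [set: R] (EFin \o f t).
  apply: (@dominated_integrable1 _ (fun z => k t * l z)) => //.
    exact: (measurable_fun_pair2 (f := fun z : measurableTypeR R * measurableTypeR R => f z.1 z.2) t mf).
  by have := @integrableZl _ _ R mu setT measurableT (k t) _ li; apply: eq_integrable.
have i2 z : mu.-integrable [set: R] (EFin \o f ^~ z).
  apply: (@dominated_integrable1 _ (fun t => k t * l z)) => //.
    exact: (measurable_fun_pair1 (f := fun z : measurableTypeR R * measurableTypeR R => f z.1 z.2) z mf).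
  by have := @integrableZr _ _ R mu setT measurableT (l z) _ ki; apply: eq_integrable.
pose F (z : measurableTypeR R * measurableTypeR R) := (f z.1 z.2)%:E.
have mF : measurable_fun setT F by exact/measurable_EFinP.
have iF : (mu \x mu)%E.-integrable setT F.
  apply: (@integrable12ltyP _ _ _ _ R mu mu F mF).2.
  have kl_ge0 t z : 0 <= k t * l z by exact: le_trans (fkl t z).
  apply: (@le_lt_trans _ _ (\int[mu]_t (`|k t| * \int[mu]_z `|l z|)%:E)%E).
    apply: ge0_le_integral => //.
    - by move=> t _; apply: integral_ge0.
    - apply: (measurable_fun_fubini_tonelli_F (abse \o F)) => //=.
      exact: measurableT_comp.
    - apply/measurable_EFinP; apply: measurable_funM; last exact: measurable_cst.
      by apply: measurableT_comp => //; apply/measurable_EFinP; case/integrableP: ki.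
    move=> t _; apply: (@le_trans _ _ (\int[mu]_z (`|k t| * `|l z|)%:E)%E).
      apply: ge0_le_integral => //.
      + by apply: measurableT_comp => //; case/integrableP: (i1 t).
      + apply/measurable_EFinP; apply: measurable_funM; first exact: measurable_cst.
        by apply: measurableT_comp => //; apply/measurable_EFinP; case/integrableP: li.
      + move=> z _; rewrite lee_fin (le_trans (fkl t z))//.
        by rewrite -normrM ler_norm.
    under eq_integral do rewrite EFinM.
    rewrite ge0_integralZl//; last first.
      apply/measurable_EFinP; apply: measurableT_comp => //.
      by apply/measurable_EFinP; case/integrableP: li.
    rewrite EFinM lee_wpmul2l// /Rintegral fineK//.
    by apply: integrable_fin_num => //; exact: (@integrable_norm _ _ R mu).
  have /integrableP[_] : mu.-integrable [set: R] (EFin \o (fun t => `|k t| * \int[mu]_z `|l z|)).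
    have := @integrableZr _ _ R mu setT measurableT (\int[mu]_z `|l z|) _ (@integrable_norm _ _ R mu setT k ki).
    exact: eq_integrable.
  apply: le_lt_trans; apply: ge0_le_integral => //.
  - by move=> t _; rewrite lee_fin mulr_ge0// Rintegral_ge0.
  - apply/measurable_EFinP; apply: measurable_funM; last exact: measurable_cst.
    by apply: measurableT_comp => //; apply/measurable_EFinP; case/integrableP: ki.
  - apply: measurableT_comp => //; apply/measurable_EFinP; apply: measurable_funM; last exact: measurable_cst.
    by apply: measurableT_comp => //; apply/measurable_EFinP; case/integrableP: ki.
  - by move=> t _; exact: (lee_abs).
have := Fubini iF; rewrite /F/= => E; rewrite /Rintegral.
transitivity (fine (\int[mu]_x \int[mu]_y (f x y)%:E)%E).
  by congr fine; apply: eq_integral => t _; rewrite fineK//; exact: integrable_fin_num (i1 t).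
rewrite E; congr fine; apply: eq_integral => z _; rewrite fineK//.
exact: integrable_fin_num (i2 z).
Qed.

(** Chain rule along a graph: the velocity of s |-> (s, g s) is
(1, 0) + d (0, 1). *)
Lemma is_derive_along (phi : R * R -> R) (g : R -> R) (t d : R) :
  differentiable phi (t, g t) -> is_derive t 1 g d ->
  is_derive t 1 (fun s => phi (s, g s)) ('D_(1, 0) phi (t, g t) + d * 'D_(0, 1) phi (t, g t)).
Proof.
move=> dphi gd.
have dg : differentiable g t by apply/derivable1_diffP; case: gd.
have did : differentiable (id : R -> R) t by apply/derivable1_diffP; exact: derivable_id.
pose gam (s : R) : R * R := (s, g s).
have dgam : differentiable gam t by exact: differentiable_pair.
have dc : differentiable (phi \o gam) t by exact: differentiable_comp.
have -> : (fun s => phi (s, g s)) = phi \o gam by [].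
apply: DeriveDef; first exact/derivable1_diffP.
rewrite deriveE// diff_comp//= diff_pair//=.
have -> : 'd g t 1 = d by rewrite -deriveE//; case: gd.
have -> : 'd (id : R -> R) t 1 = 1 by rewrite -deriveE// derive_id.
have -> : (1, d) = (1, 0) + d *: (0, 1) :> R * R.
  by congr pair; rewrite /= ?scaler0 ?addr0 ?add0r// [RHS]mulr1.
by rewrite linearD linearZ/= -!deriveE.
Qed.

End fubini_chain.

Section transported_density.
Context {R : realType}.
Notation mu := (@lebesgue_measure R).
Variables r v : R -> R.
Hypotheses (r_int : mu.-integrable [set: R] (EFin \o r)) (r_ge0 : forall x, 0 <= r x)
  (r_out : forall x, x \notin `]0, 1[ -> r x = 0).
Hypotheses (v_int : mu.-integrable [set: R] (EFin \o v)) (v_ge0 : forall x, 0 <= v x).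

Definition transported c (t x : R) : R := dens r v c (prim c t - x).

Let dI := dens_int r_int r_ge0 v_int v_ge0.

Lemma transported_int c t : positive_rate c ->
  mu.-integrable [set: R] (EFin \o transported c t).
Proof. by move=> ec; apply: (integrable_reflect _ (dI ec)). Qed.

Lemma transported_C0L1 c (S : R) : positive_rate c -> in_C0L1 S (transported c).
Proof.
move=> ec; split=> t tS.
  by apply: integrable_setT_in => //; exact: transported_int.
apply: cvg_within_filter.
apply: (@cvg_comp _ _ _ (prim c) (fun b => \int[mu]_(x in `]0, 1[) `|dens r v c (b - x) - dens r v c (prim c t - x)|) _ (nbhs (prim c t))).
  exact: prim_continuous.
exact: (translation_continuous (prim c t) (dI ec)).
Qed.

(** The substitution z = a - x, with the space window carried by an indicator. *)
Lemma dens_window c (a : R) (D : set R) (g : R -> R) (M : R) : positive_rate c -> measurable D ->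
  measurable_fun [set: R] g -> (forall x, `|g x| <= M) ->
  \int[mu]_(x in D) (dens r v c (a - x) * g x) =
  \int[mu]_z (dens r v c z * (\1_D (a - z) * g (a - z))).
Proof.
move=> ec mD mg gM; rewrite Rintegral_indic.
have mgD : measurable_fun [set: R] (fun z => \1_D (a - z) * g (a - z)).
  apply: (@measurableT_comp _ _ _ _ _ _ (fun x => \1_D x * g x)).
    by apply: measurable_funM => //; exact: measurable_indic.
  exact: reflect_measurable.
have M0 : 0 <= M by exact: le_trans (gM 0).
rewrite -[RHS](@Rintegral_reflect _ a).
  by apply: eq_Rintegral => x _; rewrite subKr mulrAC mulrA.
apply: (@integrable_bdd _ _ _ _ M) => //; first exact: dI.
move=> x _; rewrite normrM indicE; case: (_ \in _); rewrite ?normr1 ?mul1r//.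
by rewrite normr0 mul0r.
Qed.

Let rN z := r (- z).

(** The labels present at time t are those in ]prim c t - 1, prim c t]. Against
dens, the initial part counts labels in ]prim c t - 1, 0] and the inflow counts
those entered by time t, whence a difference of cumulative masses. *)
Lemma transported_mass c t : positive_rate c -> 0 <= t ->
  total_mass (transported c) t =
  entered (cdf rN) (cdf v) t - delayed (cdf rN) (cdf v) c (prim c t).
Proof.
move=> ec t0; rewrite /total_mass /transported.
rewrite Rintegral_itv_obnd_cbnd; last first.
  by apply: integrable_setT_in => //; exact: transported_int.
transitivity (\int[mu]_(x in `[0, 1[) (dens r v c (prim c t - x) * cst 1 x)).
  by apply: eq_Rintegral => x _; rewrite /= mulr1.
rewrite (@dens_window c _ _ (cst 1) 1)//; last by move=> x; rewrite normr1.
have mI (a : R) : measurable_fun [set: R] (fun z => \1_(`[0, 1[) (a - z) * cst 1 (a - z) : R).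
  have -> : (fun z => \1_(`[0, 1[) (a - z) * cst 1 (a - z) : R) = (\1_(`[0, 1[) : R -> R) \o (fun z => a - z).
    by apply/funext => z; rewrite /= mulr1.
  by apply: measurableT_comp; [exact: measurable_indic|exact: reflect_measurable].
rewrite (@dens_formula _ r v r_int r_ge0 v_int v_ge0 c _ 1)//; last first.
  by move=> z; rewrite /= mulr1 indic_le1.
rewrite /entered /delayed /mass_upto opprD addrACA.
have rNi : mu.-integrable [set: R] (EFin \o rN) by exact: rN_int.
have cE (f : R -> R) s : mu.-integrable [set: R] (EFin \o f) -> 
   cdf f s = \int[mu]_x (f x * \1_(`]-oo, s]) x) by move=> fi; exact: Rintegral_indic.
have cN s : cdf rN s = \int[mu]_x (r x * \1_(`]-oo, s]) (- x)).
  rewrite cE// -(Rintegral_preserving opp_measurable opp_preserving); last exact: integrable_indic_mul.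
  by apply: eq_Rintegral => x _; rewrite /rN opprK.
congr (_ + _).
  have iN s : mu.-integrable [set: R] (EFin \o (fun x => r x * \1_(`]-oo, s]) (- x))).
    apply: (@integrable_bdd _ _ _ _ 1) => //; last by move=> x _; exact: indic_le1.
    by apply: measurableT_comp; [exact: measurable_indic|exact: opp_measurable].
  rewrite !cN -RintegralB//; apply: eq_Rintegral => x _; rewrite /= mulr1 -mulrBr.
  have [x01|/r_out ->] := boolP (x \in `]0, 1[); last by rewrite !mul0r.
  congr (_ * _); move: x01; rewrite in_itv/= => /andP[x0 x1].
  have p0 : 0 <= prim c t by rewrite -(prim0 c) prim_mono.
  rewrite !indicE !mem_setE !in_itv/= opprK oppr_le0 (ltW x0) (_ : 0 <= _); last lra.
  have -> : (- x <= prim c t - 1) = ~~ (prim c t + x < 1) by rewrite -leNgt; apply/idP/idP; lra.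
  by case: (_ < 1); rewrite /= ?subr0 ?subrr.
have iv s : mu.-integrable [set: R] (EFin \o (fun x => v x * \1_(`]-oo, s]) x)).
  exact: integrable_indic_mul.
rewrite !cE// -RintegralB//; apply: eq_Rintegral => s _; rewrite /= mulr1 -mulrBr; congr (_ * _).
rewrite !indicE !mem_setE !in_itv/= subr_ge0 prim_mono// prim_inv_ge//.
have -> : (prim c s <= prim c t - 1) = ~~ (prim c t - prim c s < 1) by rewrite -leNgt; apply/idP/idP; lra.
have [h|h] := ltP (prim c t - prim c s) 1; rewrite ?andbT ?andbF ?subr0//=.
have -> : s <= t by rewrite -(prim_mono ec); lra.
by rewrite subrr.
Qed.

Lemma transported_measurable c : positive_rate c ->
  measurable_fun [set: measurableTypeR R * measurableTypeR R] (fun z => transported c z.1 z.2).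
Proof.
move=> ec; apply: (@measurableT_comp _ _ _ _ _ _ (dens r v c)).
  exact: dens_measurable.
apply: measurable_funB => //.
by apply: measurableT_comp => //; exact: prim_measurable.
Qed.

Lemma transported_ge0 c t x : positive_rate c -> 0 <= transported c t x.
Proof. by move=> ec; exact: dens_ge0. Qed.

End transported_density.

(** * The transported density solves the linear equation *)

Section weak_helpers.
Context {R : realType}.
Notation mu := (@lebesgue_measure R).

Lemma Rintegral_zero (D : set R) : measurable D -> \int[mu]_(x in D) (0 : R) = 0.
Proof. by move=> mD; have := @Rintegral_cst _ _ R mu D mD 0; rewrite mul0r. Qed.

Lemma FTC_oo (f F : R -> R) (a b : R) : a < b -> continuous f -> continuous F ->
  (forall x, x \in `]a, b[ -> is_derive x 1 F (f x)) ->
  \int[mu]_(x in `]a, b[) f x = F b - F a.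
Proof.
move=> ab cf cF dF.
have icc : mu.-integrable `[a, b] (EFin \o f) by exact: continuous_integrable.
have ico : mu.-integrable `[a, b[ (EFin \o f).
  by apply: (@integrableS _ _ R mu `[a, b]%classic) => //; exact: subset_itv_co_cc.
have ioo : mu.-integrable `]a, b[ (EFin \o f).
  by apply: (@integrableS _ _ R mu `[a, b]%classic) => //; exact: subset_itv_oo_cc.
rewrite Rintegral_itv_obnd_cbnd// Rintegral_itv_bndo_bndc// /Rintegral.
rewrite (@continuous_FTC2 _ f F)//.
- exact: continuous_subspaceT.
- split.
  + by move=> x xab; have [h _] := dF x xab.
  + by apply: cvg_at_right_filter; exact: cF.
  + by apply: cvg_at_left_filter; exact: cF.
- by move=> x xab; rewrite derive1E; have [_ ->] := dF x xab.
Qed.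

Definition clamp2 (tau : R) (z : R * R) : R * R := (clamp 0 tau z.1, clamp 0 1 z.2).

Lemma clamp2_continuous tau : continuous (clamp2 tau).
Proof.
apply: continuous_pair => z.
  by apply: (@continuous_comp _ _ _ fst (clamp 0 tau)); [exact: cvg_fst|exact: clamp_continuous].
by apply: (@continuous_comp _ _ _ snd (clamp 0 1)); [exact: cvg_snd|exact: clamp_continuous].
Qed.

Lemma clamp2_rect tau z : 0 <= tau -> closed_rectangle tau (clamp2 tau z).
Proof. by move=> t0; split; rewrite /=; apply: clamp_itv => //; exact: ler01. Qed.

Lemma clamp2_id tau z : closed_rectangle tau z -> clamp2 tau z = z.
Proof. by case: z => t x [/= t1 x1]; rewrite /clamp2/= !clamp_id. Qed.

Lemma continuous_clamp2 tau (f : R * R -> R) : 0 <= tau ->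
  {within closed_rectangle tau, continuous f} -> continuous (f \o clamp2 tau).
Proof.
move=> t0; apply: continuous_comp_within; first exact: clamp2_continuous.
by move=> z; exact: clamp2_rect.
Qed.

Lemma bounded_clamp2 tau (f : R * R -> R) : 0 <= tau ->
  {within closed_rectangle tau, continuous f} ->
  exists M : R, forall z, `|f (clamp2 tau z)| <= M.
Proof.
move=> t0 cf.
have cpt : compact (closed_rectangle tau : set (R * R)).
  by apply: compact_setX; exact: segment_compact.
have [M [_ hM]] := compact_bounded (continuous_compact cf cpt).
exists (M + 1) => z; apply: (hM (M + 1)); first by rewrite ltrDl.
by exists (clamp2 tau z) => //; exact: clamp2_rect.
Qed.

Lemma open_rectangle_near (tau : R) (z : R * R) : open_rectangle tau z ->
  \forall y \near z, open_rectangle tau y.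
Proof.
case: z => t x [/= ht hx]; exists (`]0, tau[%classic, `]0, 1[%classic) => //=.
by split; apply: near_in_itvoo.
Qed.

End weak_helpers.

Section weak_formulation.
Context {R : realType}.
Notation mu := (@lebesgue_measure R).
Variables (T : R) (r v : R -> R).
Hypotheses (r_int : mu.-integrable [set: R] (EFin \o r)) (r_ge0 : forall x, 0 <= r x)
  (r_out : forall x, x \notin `]0, 1[ -> r x = 0).
Hypotheses (v_int : mu.-integrable [set: R] (EFin \o v)) (v_ge0 : forall x, 0 <= v x)
  (v_out : forall x, x \notin `]0, T[ -> v x = 0).
Variables (c : R -> R) (tau : R) (phi phit phix : R * R -> R).
Hypotheses (ec : positive_rate c) (tau0 : 0 < tau).
Hypotheses (cphi : {within closed_rectangle tau, continuous phi})
  (dphi : forall z, open_rectangle tau z -> differentiable phi z)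
  (cphit : {within closed_rectangle tau, continuous phit})
  (cphix : {within closed_rectangle tau, continuous phix})
  (Dphi : forall z, open_rectangle tau z -> 'D_(1, 0) phi z = phit z /\ 'D_(0, 1) phi z = phix z).
Hypotheses (phi_end : forall x, x \in `[0, 1] -> phi (tau, x) = 0)
  (phi_right : forall t, t \in `[0, tau] -> phi (t, 1) = 0).

Let xi := prim c.
Let phic z := phi (clamp2 tau z).
Let psi t x : R := phit (clamp2 tau (t, x)) + c (clamp 0 tau t) * phix (clamp2 tau (t, x)).
(** k t z is the derivative of the test function along the path of label z,
while that path is inside ]0, tau[ x ]0, 1[. *)
Let k t z : R := \1_(`]0, tau[) t * (\1_(`]0, 1[) (xi t - z) * psi t (xi t - z)).
(** Minus the value of the test function at the entrance point of label z in the
rectangle: (0, - z) for initial mass, (prim_inv c z, 0) for inflow. *)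
Let Gam z : R := - (\1_(`]-1, 0]) z * phic (0, - z) + \1_(`]0, xi tau[) z * phic (prim_inv c z, 0)).

Local Lemma c_cont : continuous c. Proof. by case: ec. Qed.

Local Lemma phic_cont : continuous phic.
Proof. by apply: continuous_clamp2 => //; exact: ltW. Qed.

Local Lemma psi_cont : continuous (fun z : R * R => psi z.1 z.2).
Proof.
have e (f : R * R -> R) : {within closed_rectangle tau, continuous f} ->
    continuous (fun z : R * R => f (clamp2 tau (z.1, z.2))).
  move=> cf; have -> : (fun z : R * R => f (clamp2 tau (z.1, z.2))) = f \o clamp2 tau.
    by apply/funext => -[t x].
  exact: continuous_clamp2 (ltW tau0) cf.
move=> z; apply: cvgD; first exact: (e _ cphit).
apply: cvgM; last exact: (e _ cphix).
apply: (@continuous_comp _ _ _ (fun z : R * R => clamp 0 tau z.1) c); last exact: c_cont.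
by apply: (@continuous_comp _ _ _ fst (clamp 0 tau)); [exact: cvg_fst|exact: clamp_continuous].
Qed.

Local Lemma psi_bdd : exists2 M, 0 <= M & forall t x, `|psi t x| <= M.
Proof.
have [M1 h1] := bounded_clamp2 (ltW tau0) cphit.
have [M2 h2] := bounded_clamp2 (ltW tau0) cphix.
have [M3 h3] := continuous_bounded_itv 0 tau c_cont.
have h t x : `|psi t x| <= M1 + M3 * M2.
  rewrite (le_trans (ler_normD _ _))// lerD// normrM ler_pM//.
  by apply: h3; apply: clamp_itv; exact: ltW.
by exists (M1 + M3 * M2) => //; exact: le_trans (h 0 0).
Qed.

Local Lemma phic_bdd : exists M, forall z, `|phic z| <= M.
Proof. by have [M h] := bounded_clamp2 (ltW tau0) cphi; exists M => z; exact: h. Qed.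

Local Lemma along_cont (f : R * R -> R) z : continuous f -> continuous (fun t => f (t, xi t - z)).
Proof.
move=> cf t; apply: (@continuous_comp _ _ _ (fun t => (t, xi t - z)) f); last exact: cf.
apply: continuous_pair => s; first exact: cvg_id.
by apply: cvgB; [exact: prim_continuous|exact: cvg_cst].
Qed.

Local Lemma phic_along z t : open_rectangle tau (t, xi t - z) ->
  is_derive t 1 (fun s => phic (s, xi s - z)) (psi t (xi t - z)).
Proof.
move=> ho.
have dxi : is_derive t 1 (fun s => xi s - z) (c t).
  by rewrite -[X in is_derive _ _ _ X]subr0; apply: is_deriveB; exact: rate_derive.
have cl : closed_rectangle tau (t, xi t - z).
  by case: ho => h1 h2; split; [exact: subset_itv_oo_cc h1|exact: subset_itv_oo_cc h2].
have [D1 D2] := Dphi ho.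
have := is_derive_along (dphi ho) dxi.
rewrite D1 D2 => h.
have -> : psi t (xi t - z) = phit (t, xi t - z) + c t * phix (t, xi t - z).
  by rewrite /psi clamp2_id//; case: cl => /= h1 _; rewrite clamp_id.
apply: near_eq_is_derive h.
have cg : {for t, continuous (fun s => (s, xi s - z))}.
  apply: continuous_pair => s; first exact: cvg_id.
  by apply: cvgB; [exact: prim_continuous|exact: cvg_cst].
have H : nbhs t [set s | open_rectangle tau (s, xi s - z)] := cg _ (open_rectangle_near ho).
apply: filterS H => s [/= h1 h2].
by rewrite /phic clamp2_id//; split; [exact: subset_itv_oo_cc h1|exact: subset_itv_oo_cc h2].
Qed.

(** The path is inside the rectangle for times in ]al, be[. It exits through
x = 1 or t = tau, where the test function vanishes, so only the entrance value
survives in the fundamental theorem of calculus. *)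
Local Lemma int_along z : \int[mu]_t k t z = Gam z.
Proof.
pose al := Num.max 0 (prim_inv c z); pose be := Num.min tau (prim_inv c (z + 1)).
have zz : prim_inv c z < prim_inv c (z + 1) by rewrite prim_inv_mono_lt// ltrDl.
have kE t : k t z = psi t (xi t - z) * \1_(`]al, be[) t.
  rewrite /k mulrA mulrC; congr (_ * _).
  rewrite !indicE !mem_setE !in_itv/= -natrM mulnb; congr (nat_of_bool _)%:R.
  rewrite /al /be gt_max lt_min prim_inv_lt// prim_inv_gt// subr_gt0 ltrBlDr (addrC 1).
  by rewrite -!andbA; congr (_ && _); rewrite andbCA.
under eq_Rintegral do rewrite kE.
rewrite -Rintegral_indic.
have [ab|ba] := ltP al be; last first.
  rewrite set_itv_ge ?bnd_simp -?leNgt// Rintegral_set0.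
  rewrite /Gam !indicE !mem_setE !in_itv/=.
  have p0 : 0 < prim c tau by rewrite -(prim0 c) prim_mono_lt.
  have -> : (-1 < z <= 0) = false.
    apply/negP => /andP[z1 z0]; move: ba; rewrite leNgt => /negP; apply.
    rewrite /al /be gt_max !lt_min tau0/= zz andbT prim_inv_gt// prim0.
    by rewrite prim_inv_lt//; apply/andP; split; lra.
  have -> : (0 < z < xi tau) = false.
    apply/negP => /andP[z1 z0]; move: ba; rewrite leNgt => /negP; apply.
    rewrite /al /be gt_max !lt_min tau0/= zz andbT prim_inv_gt// prim0 prim_inv_lt//.
    by apply/andP; split; [lra|exact: z0].
  by rewrite !mul0r addr0 oppr0.
have cpsi : continuous (fun t => psi t (xi t - z)).
  exact: (@along_cont _ z psi_cont).
have cG : continuous (fun t => phic (t, xi t - z)) by apply: along_cont; exact: phic_cont.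
have dG t : t \in `]al, be[ ->
    is_derive t 1 (fun t => phic (t, xi t - z)) (psi t (xi t - z)).
  rewrite in_itv/= /al /be gt_max lt_min => /andP[/andP[t0 tz] /andP[tt tz1]].
  move: tz tz1; rewrite prim_inv_lt// prim_inv_gt// => tz tz1.
  by apply: phic_along; split; rewrite /= in_itv/= ?t0 ?tt// subr_gt0 tz ltrBlDr addrC.
rewrite (FTC_oo ab cpsi cG dG).
have al0 : 0 <= al by rewrite le_max lexx.
have bet : be <= tau by rewrite ge_min lexx.
have Gbe : phic (be, xi be - z) = 0.
  rewrite /phic /clamp2/= [clamp 0 tau be]clamp_id; last by rewrite in_itv/= bet (le_trans al0)// ltW.
  rewrite /be; have [h|h] := leP tau (prim_inv c (z + 1)).
    by apply: phi_end; apply: clamp_itv; exact: ler01.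
  rewrite /xi prim_invK// addrAC subrr add0r clamp_id ?in_itv/= ?ler01 ?lexx//.
  apply: phi_right; rewrite in_itv/= (ltW h) andbT.
  by move: ab; rewrite /be min_r ?(ltW h)// => /ltW; exact: le_trans.
rewrite Gbe sub0r /Gam; congr (- _).
rewrite !indicE !mem_setE !in_itv/=.
have [z0|z0] := leP z 0.
  have alE : al = 0 by rewrite /al max_l// prim_inv_le// prim0.
  have -> : -1 < z.
    move: ab; rewrite alE /be lt_min prim_inv_gt// prim0 => /andP[_]; lra.
  by rewrite alE /xi prim0 sub0r/= mul1r mul0r addr0.
have alE : al = prim_inv c z by rewrite /al max_r// prim_inv_ge// prim0 ltW.
have -> : z < xi tau.
  by move: ab; rewrite alE /be lt_min prim_inv_lt// => /andP[].
by rewrite alE /xi prim_invK// subrr andbF mul0r add0r mul1r.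
Qed.

Local Lemma Gam_meas : measurable_fun [set: R] Gam.
Proof.
apply: measurable_funN; apply: measurable_funD.
  apply: measurable_funM; first exact: measurable_indic.
  apply: continuous_measurable_fun => z.
  apply: (@continuous_comp _ _ _ (fun z => (0 : R, - z)) phic); last exact: phic_cont.
  by apply: continuous_pair => s; [exact: cvg_cst|apply: cvgN; exact: cvg_id].
apply: measurable_funM; first exact: measurable_indic.
apply: continuous_measurable_fun => z.
apply: (@continuous_comp _ _ _ (fun z => (prim_inv c z, 0 : R)) phic); last exact: phic_cont.
by apply: continuous_pair => s; [exact: prim_inv_continuous|exact: cvg_cst].
Qed.

Local Lemma Gam_bdd : exists M, forall z, `|Gam z| <= M.
Proof.
have [M h] := phic_bdd; exists (M + M) => z.
rewrite normrN (le_trans (ler_normD _ _))// lerD//.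
  by rewrite normrM -[leRHS]mul1r ler_pM// indic_le1.
by rewrite normrM -[leRHS]mul1r ler_pM// indic_le1.
Qed.

Local Lemma k_meas : measurable_fun [set: measurableTypeR R * measurableTypeR R] (fun z => k z.1 z.2).
Proof.
have mxi : measurable_fun [set: measurableTypeR R * measurableTypeR R] (fun z => xi z.1 - z.2).
  apply: measurable_funB => //.
  by apply: measurableT_comp => //; exact: prim_measurable.
apply: measurable_funM.
  by apply: measurableT_comp => //; exact: measurable_indic.
apply: measurable_funM.
  by apply: measurableT_comp => //; exact: measurable_indic.
apply: (@continuous_measurable2 _ (fun z => psi z.1 (xi z.1 - z.2))) => z.
apply: (@continuous_comp _ _ _ (fun z : R * R => (z.1, xi z.1 - z.2)) (fun z => psi z.1 z.2)); last exact: psi_cont.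
apply: continuous_pair => s; first exact: cvg_fst.
apply: cvgB; last exact: cvg_snd.
by apply: (@continuous_comp _ _ _ fst xi); [exact: cvg_fst|exact: prim_continuous].
Qed.

Local Lemma k_bound M : (forall t x, `|psi t x| <= M) ->
  forall t z, `|k t z| <= M * \1_(`]0, tau[) t.
Proof.
move=> psiM t z.
rewrite /k normrM mulrC; apply: ler_pM => //; last by rewrite ger0_norm// indicE.
by rewrite normrM -[leRHS]mul1r ler_pM// indic_le1.
Qed.

Local Lemma itv_int (M : R) : mu.-integrable [set: R] (EFin \o (fun t => M * \1_(`]0, tau[) t)).
Proof.
have : mu.-integrable `]0, tau[ (EFin \o cst M).
  apply: (@integrableS _ _ R mu `[0, tau]%classic) => //; first exact: subset_itv_oo_cc.
  by apply: (@continuous_integrable _ (cst M)) => x; exact: cvg_cst.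
move/(@integrable_mkcond _ _ R mu _ _ (measurable_itv _)); apply: eq_integrable => // z _.
by rewrite patchE/= indicE; case: ifP; rewrite (mulr1, mulr0).
Qed.

Local Lemma k_int z : mu.-integrable [set: R] (EFin \o k ^~ z).
Proof.
have [M M0 psiM] := psi_bdd.
apply: (dominated_integrable1 measurableT _ (itv_int M)).
  exact: (measurable_fun_pair1 (f := fun z : measurableTypeR R * measurableTypeR R => k z.1 z.2) z k_meas).
by move=> t _; exact: k_bound.
Qed.

(** Integrating in t first is what makes paths appear; the integrand is
dominated by a product of functions of t and z. *)
Local Lemma dens_k_fubini :
  \int[mu]_t \int[mu]_z (dens r v c z * k t z) = \int[mu]_z (dens r v c z * Gam z).
Proof.
have [M M0 psiM] := psi_bdd.
have dens_i : mu.-integrable [set: R] (EFin \o dens r v c) by exact: dens_int.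
have md : measurable_fun [set: measurableTypeR R * measurableTypeR R]
    (fun z => dens r v c z.2 * k z.1 z.2).
  apply: measurable_funM; last exact: k_meas.
  apply: (@measurableT_comp _ _ _ _ _ _ (dens r v c)); first exact: dens_measurable.
  exact: measurable_snd.
have dkM t z : `|dens r v c z * k t z| <= M * \1_(`]0, tau[) t * dens r v c z.
  rewrite normrM mulrC; apply: ler_pM; [exact: normr_ge0|exact: normr_ge0|exact: k_bound|].
  by rewrite ger0_norm ?lexx//; exact: dens_ge0.
rewrite (Rfubini md (itv_int M) dens_i dkM); apply: eq_Rintegral => z _.
by rewrite (@RintegralZl _ _ R mu setT _ _ measurableT (k_int z)) int_along.
Qed.

Local Lemma phic_in t x : t \in `[0, tau] -> x \in `[0, 1] -> phic (t, x) = phi (t, x).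
Proof. by move=> tt xx; rewrite /phic clamp2_id. Qed.

Local Lemma initial_term :
  \int[mu]_x (r x * Gam (- x)) = - \int[mu]_(x in `]0, 1[) (r x * phi (0, x)).
Proof.
have t00 : 0 \in `[0, tau] by rewrite in_itv/= lexx ltW.
have [M' hM'] := phic_bdd.
have mph : measurable_fun [set: R] (fun x => \1_(`]0, 1[) x * phic (0, x)).
  apply: measurable_funM; first exact: measurable_indic.
  apply: continuous_measurable_fun => x.
  apply: (@continuous_comp _ _ _ (fun x : R => (0 : R, x)) phic); last exact: phic_cont.
  by apply: continuous_pair => s; [exact: cvg_cst|exact: cvg_id].
have bph x : [set: R] x -> `|\1_(`]0, 1[) x * phic (0, x)| <= M'.
  by move=> _; rewrite normrM -[leRHS]mul1r ler_pM// indic_le1.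
have E x : r x * (\1_(`]0, 1[) x * phic (0, x)) = r x * phi (0, x) * \1_(`]0, 1[) x.
  rewrite indicE mem_setE; have [x01|_] := boolP (x \in `]0, 1[); last by rewrite mul0r !mulr0.
  by rewrite mul1r mulr1 phic_in//; exact: subset_itv_oo_cc x01.
have iI := integrable_bdd measurableT r_int mph bph.
rewrite [in RHS]Rintegral_indic -mulN1r.
under [in RHS]eq_Rintegral do rewrite -E.
rewrite -(@RintegralZl _ _ R mu setT _ (- 1) measurableT iI).
apply: eq_Rintegral => x _.
have [x01|/r_out ->] := boolP (x \in `]0, 1[); last by rewrite !mul0r mulr0.
rewrite /Gam !indicE !mem_setE x01 mul1r.
move: x01; rewrite !in_itv/= => /andP[x0 x1].
rewrite ltrN2 x1 oppr_le0 (ltW x0)/= oppr_gt0 ltNge (ltW x0)/= mul1r mul0r addr0 opprK.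
by rewrite mulN1r mulrN.
Qed.

Local Lemma boundary_term :
  \int[mu]_s (v s * Gam (prim c s)) = - \int[mu]_(t in `]0, tau[) (v t * phi (t, 0)).
Proof.
have x00 : (0 : R) \in `[0, 1] by rewrite in_itv/= lexx ler01.
have [M' hM'] := phic_bdd.
have mph : measurable_fun [set: R] (fun x => \1_(`]0, tau[) x * phic (x, 0)).
  apply: measurable_funM; first exact: measurable_indic.
  apply: continuous_measurable_fun => x.
  apply: (@continuous_comp _ _ _ (fun x : R => (x, 0 : R)) phic); last exact: phic_cont.
  by apply: continuous_pair => s; [exact: cvg_id|exact: cvg_cst].
have bph x : [set: R] x -> `|\1_(`]0, tau[) x * phic (x, 0)| <= M'.
  by move=> _; rewrite normrM -[leRHS]mul1r ler_pM// indic_le1.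
have E x : v x * (\1_(`]0, tau[) x * phic (x, 0)) = v x * phi (x, 0) * \1_(`]0, tau[) x.
  rewrite indicE mem_setE; have [x01|_] := boolP (x \in `]0, tau[); last by rewrite mul0r !mulr0.
  by rewrite mul1r mulr1 phic_in//; exact: subset_itv_oo_cc x01.
have iI := integrable_bdd measurableT v_int mph bph.
rewrite [in RHS]Rintegral_indic -mulN1r.
under [in RHS]eq_Rintegral do rewrite -E.
rewrite -(@RintegralZl _ _ R mu setT _ (- 1) measurableT iI).
apply: eq_Rintegral => s _.
have [s0|/v_out ->] := boolP (s \in `]0, T[); last by rewrite !mul0r mulr0.
rewrite /Gam !indicE !mem_setE !in_itv/=.
move: s0; rewrite in_itv/= => /andP[s0 _].
have ps0 : 0 < prim c s by rewrite -(prim0 c) prim_mono_lt.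
rewrite (leNgt (prim c s) 0) ps0 andbF mul0r add0r s0/= primK//.
rewrite (prim_mono_lt ec) /= mulN1r.
by rewrite mulrN.
Qed.

(** Replace x by the label xi t - x, integrate along paths, and split the mass
over labels into initial part and inflow: the entrance values are the data terms
with the opposite sign. *)
Lemma transported_weak :
  \int[mu]_(t in `]0, tau[) \int[mu]_(x in `]0, 1[)
     (transported r v c t x * ('D_(1, 0) phi (t, x) + c t * 'D_(0, 1) phi (t, x)))
  + \int[mu]_(t in `]0, tau[) (v t * phi (t, 0))
  + \int[mu]_(x in `]0, 1[) (r x * phi (0, x)) = 0.
Proof.
have [M M0 psiM] := psi_bdd.
pose d := dens r v c.
have mpsi t : measurable_fun [set: R] (psi t).
  apply: continuous_measurable_fun => x.
  apply: (@continuous_comp _ _ _ (fun x : R => (t, x)) (fun z => psi z.1 z.2)); last exact: psi_cont.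
  by apply: continuous_pair => s; [exact: cvg_cst|exact: cvg_id].
have E1 : \int[mu]_(t in `]0, tau[) \int[mu]_(x in `]0, 1[)
     (transported r v c t x * ('D_(1, 0) phi (t, x) + c t * 'D_(0, 1) phi (t, x))) =
   \int[mu]_t \int[mu]_z (d z * k t z).
  rewrite Rintegral_indic; apply: eq_Rintegral => t _.
  rewrite indicE mem_setE; have [tt|tt] := boolP (t \in `]0, tau[); last first.
    rewrite mulr0 -[LHS](Rintegral_zero measurableT); apply: eq_Rintegral => z _.
    by rewrite /k indicE mem_setE (negbTE tt) mul0r mulr0.
  rewrite mulr1; transitivity (\int[mu]_(x in `]0, 1[) (d (xi t - x) * psi t x)).
    apply: eq_Rintegral => x; rewrite mem_setE => xx.
    have ho : open_rectangle tau (t, x) by split.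
    have cl : closed_rectangle tau (t, x).
      by split; [exact: subset_itv_oo_cc tt|exact: subset_itv_oo_cc xx].
    have [-> ->] := Dphi ho.
    by rewrite /psi clamp2_id// clamp_id//; case: cl.
  rewrite (@dens_window _ r v r_int r_ge0 v_int v_ge0 c _ _ (psi t) M)//.
  by apply: eq_Rintegral => z _; rewrite /k [X in _ = _ * (X * _)]indicE mem_setE tt mul1r.
have [MG GM] := Gam_bdd.
rewrite E1 dens_k_fubini (@dens_formula _ r v r_int r_ge0 v_int v_ge0 c _ MG ec Gam_meas GM).
by rewrite initial_term boundary_term subrK addNr.
Qed.

End weak_formulation.

(** * Tools for testing against smooth steps *)

Section directional.
Context {R : realType}.

Lemma derive_fst (f : R * R -> R) (t x : R) :
  'D_(1, 0) f (t, x) = 'D_1 (fun s => f (s, x)) t.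
Proof.
have E : (fun h : R => h^-1 *: ((f \o shift (t, x)) (h *: (1, 0)) - f (t, x))) =
    (fun h => h^-1 *: (((fun s => f (s, x)) \o shift t) (h *: (1 : R)) - f (t, x))).
  apply/funext => h; congr (_ *: (f _ - _)).
  by congr pair; rewrite /= scaler0 add0r.
by rewrite /derive E.
Qed.

Lemma derive_snd (f : R * R -> R) (t x : R) :
  'D_(0, 1) f (t, x) = 'D_1 (fun y => f (t, y)) x.
Proof.
have E : (fun h : R => h^-1 *: ((f \o shift (t, x)) (h *: (0, 1)) - f (t, x))) =
    (fun h => h^-1 *: (((fun y => f (t, y)) \o shift x) (h *: (1 : R)) - f (t, x))).
  apply/funext => h; congr (_ *: (f _ - _)).
  by congr pair; rewrite /= scaler0 add0r.
by rewrite /derive E.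
Qed.

Lemma differentiable_fst (z : R * R) : differentiable (fst : R * R -> R) z.
Proof. by apply: linear_differentiable => y; exact: cvg_fst. Qed.

Lemma differentiable_snd (z : R * R) : differentiable (snd : R * R -> R) z.
Proof. by apply: linear_differentiable => y; exact: cvg_snd. Qed.

End directional.

Section pairing.
Context {R : realType}.
Notation mu := (@lebesgue_measure R).
Variables (T : R) (rho : R -> R -> R).
Hypothesis rhoC : in_C0L1 T rho.

Lemma pairing_int (f chi : R -> R) (M : R) : in_L1 0 1 f -> continuous chi ->
  (forall y, `|chi y| <= M) -> mu.-integrable `]0, 1[ (EFin \o (fun x => f x * chi x)).
Proof.
move=> fi cchi chiM; apply: (@integrable_bdd _ _ _ _ M) => //.
by apply: measurable_funTS; exact: continuous_measurable_fun.
Qed.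

(** Split the increment into the change of rho, controlled in L^1 by the bound
on chi, and the change of the shift, controlled by dominated convergence. *)
Lemma pairing_continuous (g chi : R -> R) (M : R) : continuous g -> continuous chi ->
  (forall y, `|chi y| <= M) ->
  {within `[0, T], continuous (fun t => \int[mu]_(x in `]0, 1[) (rho t x * chi (x - g t)))}.
Proof.
move=> cg cchi chiM; apply/subspace_continuousP => t tT /=.
have [rhoi rhoc] := rhoC.
have cchis s : continuous (fun x => chi (x - g s)).
  move=> x; apply: (@continuous_comp _ _ _ (fun x : R => x - g s) chi); last exact: cchi.
  by apply: cvgB; [exact: cvg_id|exact: cvg_cst].
have M0 : 0 <= M by exact: le_trans (chiM 0).
pose F s := \int[mu]_(x in `]0, 1[) (rho t x * chi (x - g s)).
have cF : {for t, continuous F}.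
  have tI : t \in `]t - 1, t + 1[ by rewrite in_itv/=; apply/andP; split; lra.
  suff h : {in (`]t - 1, t + 1[ : set R)%classic, continuous F} by apply: h; rewrite inE.
  apply: (@continuity_under_integral R _ (measurableTypeR R) mu (fun s x => rho t x * chi (x - g s))
    `]0, 1[%classic _ (t - 1) (t + 1) _ _ (fun x => M * `|rho t x|)) => //=.
  - by move=> s _; apply: (pairing_int _ (cchis s)) => //; exact: rhoi.
  - apply: aeW => x _ s _; apply: cvgM; first exact: cvg_cst.
    apply: (@continuous_comp _ _ _ (fun s : R => x - g s) chi); last exact: cchi.
    by apply: cvgB; [exact: cvg_cst|exact: cg].
  - have := @integrableZl _ _ R mu `]0, 1[%classic (measurable_itv _) M _ (@integrable_norm _ _ R mu _ _ (rhoi t tT)).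
    exact: eq_integrable.
  - by move=> s _; apply: aeW => x _; rewrite normrM mulrC ler_wpM2r.
have cFt : F s @[s --> within `[0, T] (nbhs t)] --> F t by apply: cvg_within_filter; exact: cF.
pose D s := \int[mu]_(x in `]0, 1[) `|rho s x - rho t x|.
have cD : D s @[s --> within `[0, T] (nbhs t)] --> (0 : R) by exact: rhoc.
apply/cvgrPdist_le => e e0.
have e2 : 0 < e / 2 by rewrite divr_gt0.
have eM : 0 < e / 2 / (M + 1) by rewrite divr_gt0// ltr_wpDl.
move/cvgrPdist_le : cFt => /(_ _ e2) h1.
move/cvgrPdist_le : cD => /(_ _ eM) h2.
near=> s.
have sT : s \in `[0, T] by near: s; exact: withinT.
have hF : `|F t - F s| <= e / 2 by near: s; exact: h1.
have hD : D s <= e / 2 / (M + 1).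
  have : `|0 - D s| <= e / 2 / (M + 1) by near: s; exact: h2.
  by rewrite sub0r normrN; apply: le_trans; exact: ler_norm.
have irs := pairing_int (rhoi s sT) (cchis s) (fun y => chiM _).
have irt := pairing_int (rhoi t tT) (cchis s) (fun y => chiM _).
have id : mu.-integrable `]0, 1[ (EFin \o (fun x => `|rho s x - rho t x|)).
  by apply: (@integrable_norm _ _ R mu); apply: integrable_sub => //; exact: rhoi.
have hS : `|F s - \int[mu]_(x in `]0, 1[) (rho s x * chi (x - g s))| <= e / 2.
  have mI : measurable (`]0, 1[%classic : set R) by [].
  rewrite /F -(@RintegralB _ _ R mu _ _ _ mI irt irs).
  apply: (le_trans (@le_normr_Rintegral _ _ R mu _ _ mI (integrable_sub mI irt irs))).
  apply: (@le_trans _ _ (\int[mu]_(x in `]0, 1[) (M * `|rho s x - rho t x|))).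
    apply: le_Rintegral => //.
    - by apply: (@integrable_norm _ _ R mu); exact: integrable_sub.
    - by have := @integrableZl _ _ R mu `]0, 1[%classic mI M _ id; exact: eq_integrable.
    - by move=> x _; rewrite -mulrBl normrM mulrC distrC ler_wpM2r.
  rewrite (@RintegralZl _ _ R mu _ _ _ mI id).
  apply: (@le_trans _ _ ((M + 1) * D s)); last by rewrite mulrC -ler_pdivlMr// ltr_wpDl.
  rewrite /D ler_wpM2r ?lerDl// Rintegral_ge0//.
rewrite -/(F t).
have -> : F t - \int[mu]_(x in `]0, 1[) (rho s x * chi (x - g s)) =
  (F t - F s) + (F s - \int[mu]_(x in `]0, 1[) (rho s x * chi (x - g s))) by lra.
by rewrite (le_trans (ler_normD _ _))// (splitr e) lerD.
Unshelve. all: by end_near. Qed.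

End pairing.

Section uniqueness_tools.
Context {R : realType}.
Notation mu := (@lebesgue_measure R).

Lemma prim_pos (f : R -> R) (tau : R) : continuous f -> (forall s, s <= 0 -> f s = f 0) ->
  (forall t, 0 <= f t) -> 0 < tau -> prim f tau = 0 -> f tau = 0.
Proof.
move=> cf f0 fge tau0 ptau; apply/eqP; rewrite eq_le fge andbT leNgt; apply/negP => fpos.
have ft2 : 0 < f tau / 2 by rewrite divr_gt0.
have /cvgrPdist_lt/(_ _ ft2)[d /= d0 hd] := cf tau.
(* on [s, tau] the function f stays above f tau / 2 *)
pose s := Num.max 0 (tau - d / 2).
have d2 : 0 < d / 2 by rewrite divr_gt0.
have s0 : 0 <= s by rewrite le_max lexx.
have st : s < tau by rewrite gt_max tau0/= gtrBl.
have cp : continuous (prim f) by move=> t; exact: is_derive_continuous (is_derive_prim t cf f0).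
have lb x y m : x <= y -> (forall z, z \in `[x, y] -> m <= f z) -> m * (y - x) <= prim f y - prim f x.
  move=> xy h; apply: (is_derive_lb _ _ h) => //; last exact: continuous_subspaceT.
  by move=> z _; exact: is_derive_prim.
have h1 : f tau / 2 * (tau - s) <= prim f tau - prim f s.
  apply: lb; first exact: ltW.
  move=> z; rewrite in_itv/= => /andP[sz zt].
  have : `|f tau - f z| < f tau / 2.
    apply: hd => /=; rewrite ger0_norm ?subr_ge0//.
    have : tau - d / 2 <= s by rewrite le_max lexx orbT.
    lra.
  by rewrite ltr_norml => /andP[]; lra.
have h2 : 0 * (s - 0) <= prim f s - prim f 0 by apply: lb.
move: h2 h1; rewrite prim0 ptau mul0r subr0 sub0r => h2 h1.
have : 0 < f tau / 2 * (tau - s) by rewrite mulr_gt0// subr_gt0.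
lra.
Qed.

(** Half the square of the positive part of y, written as a primitive so that
it is visibly C^1. *)
Definition ramp (y : R) : R := prim (fun s => Num.max 0 s) y.

Lemma max0_continuous : continuous (fun s : R => Num.max 0 s).
Proof. by move=> s; apply: (@continuous_max _ _ (cst 0) id); [exact: cvg_cst|exact: cvg_id]. Qed.

Lemma is_derive_ramp (y : R) : is_derive y 1 ramp (Num.max 0 y).
Proof.
apply: is_derive_prim; first exact: max0_continuous.
by move=> s s0; rewrite max_l// maxxx.
Qed.

Lemma ramp_neg y : y <= 0 -> ramp y = 0.
Proof.
move=> y0; rewrite /ramp /prim maxxx mul0r addr0 -[RHS](Rintegral_zero (measurable_itv `[0, y])).
apply: eq_Rintegral => s; rewrite mem_setE in_itv/= => /andP[s0 sy].
by rewrite max_l ?subrr// (le_trans sy).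
Qed.

Lemma ramp_ge0 y : 0 <= ramp y.
Proof.
have [y0|y0] := leP y 0; first by rewrite ramp_neg.
have := @is_derive_lb _ ramp (fun s => Num.max 0 s) 0 0 y.
rewrite (ramp_neg (lexx 0)) mul0r subr0; apply => //; last exact: ltW.
- by move=> z _; exact: is_derive_ramp.
- by apply: continuous_subspaceT => z; exact: is_derive_continuous (is_derive_ramp z).
- by move=> z _; rewrite le_max lexx.
Qed.

Lemma ramp_gt0 y : 0 < y -> 0 < ramp y.
Proof.
move=> y0; rewrite lt_neqAle ramp_ge0 andbT eq_sym; apply/eqP => h.
have m1 (s : R) : s <= 0 -> Num.max 0 s = Num.max 0 0 by move=> s0; rewrite max_l// maxxx.
have m2 (s : R) : 0 <= Num.max 0 s by rewrite le_max lexx.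
have := prim_pos max0_continuous m1 m2 y0 h.
by rewrite max_r ?(ltW y0)// => y00; rewrite y00 ltxx in y0.
Qed.

(** A C^1 function of y that vanishes for y >= b and tends, as n grows, to the
indicator of y < b. *)
Definition step (n : nat) (b y : R) : R := 1 - expR (- (n%:R * ramp (b - y))).

Definition dstep (n : nat) (b y : R) : R :=
  - expR (- (n%:R * ramp (b - y))) * (n%:R * Num.max 0 (b - y)).

Lemma is_derive_step n (b y : R) : is_derive y 1 (step n b) (dstep n b y).
Proof.
have h1 : is_derive y 1 (fun y : R => b - y) (- 1).
  by rewrite -[X in is_derive _ _ _ X]add0r; apply: is_deriveB.
have h2 := is_derive_ramp (b - y).
have h3 : is_derive y 1 (fun y => ramp (b - y)) (Num.max 0 (b - y) * - 1) := is_derive1_comp (g := fun y => b - y) h2 h1.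
have h4 : is_derive y 1 (fun y => - (n%:R * ramp (b - y))) (n%:R * Num.max 0 (b - y)).
  have := is_deriveN (is_deriveZ n%:R h3).
  move=> h; apply: (is_derive_eq h).
  by rewrite mulrN1 scalerN opprK.
have h5 := is_derive1_comp (g := fun y => - (n%:R * ramp (b - y))) (is_derive_expR (- (n%:R * ramp (b - y)))) h4.
rewrite -[X in is_derive _ _ _ X]add0r /dstep mulNr.
exact: (is_deriveB (is_derive_cst (1 : R) y 1) h5).
Qed.

Lemma step_continuous n b : continuous (step n b).
Proof. by move=> y; exact: is_derive_continuous (is_derive_step n b y). Qed.

Lemma dstep_continuous n b : continuous (dstep n b).
Proof.
have cb : continuous (fun y : R => b - y) by move=> y; apply: cvgB; [exact: cvg_cst|exact: cvg_id].
move=> y; apply: cvgM.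
  apply: cvgN; apply: (@continuous_comp _ _ _ (fun y => - (n%:R * ramp (b - y))) expR); last exact: continuous_expR.
  apply: cvgN; apply: cvgM; first exact: cvg_cst.
  apply: (@continuous_comp _ _ _ (fun y => b - y) ramp); first exact: cb.
  exact: is_derive_continuous (is_derive_ramp _).
apply: cvgM; first exact: cvg_cst.
by apply: (@continuous_comp _ _ _ (fun y => b - y) (fun s => Num.max 0 s)); [exact: cb|exact: max0_continuous].
Qed.

Lemma step_bound n b y : `|step n b y| <= 1.
Proof.
have h1 : expR (- (n%:R * ramp (b - y))) <= 1 by rewrite expR_le1 oppr_le0 mulr_ge0// ramp_ge0.
have h2 : 0 < expR (- (n%:R * ramp (b - y))) by exact: expR_gt0.
by rewrite ler_norml /step; apply/andP; split; lra.
Qed.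

Lemma step_right n b y : b <= y -> step n b y = 0.
Proof. by move=> yb; rewrite /step ramp_neg ?subr_le0// mulr0 oppr0 expR0 subrr. Qed.

Lemma step_cvg b y : step n b y @[n --> \oo] --> (\1_(`]-oo, b[) y : R).
Proof.
rewrite indicE mem_setE in_itv/=; have [yb|yb] := ltP y b; last first.
  by under eq_fun do rewrite step_right//; exact: cvg_cst.
rewrite -[X in _ --> X]subr0; apply: cvgB; first exact: cvg_cst.
pose a := ramp (b - y); have a0 : 0 < a by rewrite ramp_gt0// subr_gt0.
apply/cvgrPdist_le => e e0; near=> n.
rewrite sub0r normrN ger0_norm ?expR_ge0// expRN.
have ea : 0 < e * a by rewrite mulr_gt0.
have hn : (e * a)^-1 <= n%:R by near: n; exact: nbhs_infty_ger.
rewrite -[e]invrK lef_pV2 ?posrE ?expR_gt0 ?invr_gt0//.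
apply: le_trans (expR_ge1Dx _); rewrite -/a.
have : e^-1 <= n%:R * a by rewrite -ler_pdivrMr// -invfM.
lra.
Unshelve. all: by end_near. Qed.

End uniqueness_tools.

(** * Uniqueness for the linear equation *)

Section linear_uniqueness.
Context {R : realType}.
Notation mu := (@lebesgue_measure R).

(** As n grows, the steps give that the integral of d over ]0, y[ vanishes for
every y; then d is a.e. zero by Lebesgue differentiation. *)
Lemma vanish_ae (d : R -> R) : in_L1 0 1 d ->
  (forall n b, b <= 1 -> \int[mu]_(x in `]0, 1[) (d x * step n b x) = 0) ->
  {ae mu, forall x, x \in `]0, 1[ -> d x = 0}.
Proof.
move=> di dstep0.
have mI : measurable (`]0, 1[%classic : set R) by [].
have md : measurable_fun (`]0, 1[%classic : set R) d.
  by apply/measurable_EFinP; case/integrableP: di.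
have ind b : b <= 1 -> \int[mu]_(x in `]0, 1[) (d x * \1_(`]-oo, b[) x) = 0.
  move=> b1.
  have mst n : measurable_fun (`]0, 1[%classic : set R) (fun x => (d x * step n b x)%:E).
    apply/measurable_EFinP; apply: measurable_funM => //.
    by apply: measurable_funTS; apply: continuous_measurable_fun; exact: step_continuous.
  have mlim : measurable_fun (`]0, 1[%classic : set R) (fun x => (d x * \1_(`]-oo, b[) x)%:E).
    apply/measurable_EFinP; apply: measurable_funM; first exact: md.
    exact: measurable_indic.
  have cv : {ae mu, forall x, `]0, 1[%classic x ->
      (fun n => (d x * step n b x)%:E) @ \oo --> (d x * \1_(`]-oo, b[) x)%:E}.
    apply: aeW => x _; apply: cvg_EFin; first by near=> n.
    by apply: cvgM; [exact: cvg_cst|exact: step_cvg].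
  have dom : {ae mu, forall x n, `]0, 1[%classic x -> (`|(d x * step n b x)%:E| <= `|(EFin \o d) x|)%E}.
    apply: aeW => x n _; rewrite lee_fin normrM -[leRHS]mulr1 ler_wpM2l//.
    exact: step_bound.
  have [_ _ h] := @dominated_convergence _ _ R mu _ mI _ _ _ mst mlim cv
    (@integrable_abse _ _ R mu _ _ di) dom.
  rewrite /Rintegral -(cvg_lim _ h)//.
  have -> : (fun n => \int[mu]_(x in `]0%R, 1%R[) (d x * step n b x)%:E)%E = cst 0%E.
    apply/funext => n /=; rewrite -[LHS]fineK.
      by have := dstep0 n b b1; rewrite /Rintegral => ->.
    apply: integrable_fin_num => //.
    by apply: (pairing_int (M := 1) di) => //; [exact: step_continuous|exact: step_bound].
  by rewrite lim_cst.
pose d0 := d \_ `]0, 1[.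
have d0i : mu.-integrable [set: R] (EFin \o d0).
  by rewrite -restrict_EFin; apply/(@integrable_mkcond _ _ R mu _ _ mI).
have F0 y : \int[mu]_(x in `]-oo, y]) d0 x = 0.
  rewrite -Rintegral_itv_bndo_bndc; last exact: integrable_setT_in.
  (* only b <= 1 is allowed in the hypothesis; for y > 1 take b = 1 *)
  have [b [b1 hb]] : exists b, b <= 1 /\ forall x, x \in `]0, 1[ -> (x < y) = (x < b).
    have [y1|y1] := leP y 1; first by exists y.
    exists 1; split => // x; rewrite in_itv/= => /andP[_ x1].
    by rewrite x1 (lt_trans x1).
  rewrite -(ind b b1) Rintegral_indic [RHS]Rintegral_indic; apply: eq_Rintegral => x _.
  rewrite /d0 patchE !indicE !mem_setE; have [x01|] := boolP (x \in `]0, 1[).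
    by rewrite !in_itv/= hb// mulr1.
  by rewrite mul0r mulr0.
have lo : locally_integrable [set: R] d0.
  by apply: open_integrable_locally => //; exact: openT.
have := @FTC1Ny R d0 (fun y => integrable_setT_in (measurable_itv _) d0i) lo.
apply: filterS; first exact: (ae_filter_ringOfSetsType mu).
move=> x [_ +] x01.
have -> : (fun x => \int[mu]_(t in `]-oo, x]) d0 t) = cst 0 by apply/funext => y; exact: F0.
by rewrite derive1_cst /d0 patchE mem_setE x01.
Unshelve. all: by end_near. Qed.

Variables (T : R) (c : R -> R) (rho1 rho2 : R -> R -> R).
Hypotheses (T0 : 0 < T) (ec : positive_rate c) (C1 : in_C0L1 T rho1) (C2 : in_C0L1 T rho2).
Hypothesis same : forall (tau : R) (phi : R * R -> R), 0 < tau -> tau <= T ->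
  C1_rectangle tau phi ->
  (forall x, x \in `[0, 1] -> phi (tau, x) = 0) ->
  (forall t, t \in `[0, tau] -> phi (t, 1) = 0) ->
  \int[mu]_(t in `]0, tau[) \int[mu]_(x in `]0, 1[)
     (rho1 t x * ('D_(1, 0) phi (t, x) + c t * 'D_(0, 1) phi (t, x))) =
  \int[mu]_(t in `]0, tau[) \int[mu]_(x in `]0, 1[)
     (rho2 t x * ('D_(1, 0) phi (t, x) + c t * 'D_(0, 1) phi (t, x))).

(** Backward transport of a step from time tau along the characteristics gives
step n b (x - g t), on which the transport operator vanishes. With the factor
eta, the transport operator yields step n b (x - g t) * eta' t, so equality of
the weak integrals says that the integral of H * eta' vanishes, where H is the
difference of the pairings of rho1 and rho2 with the transported step. The
choice eta' = H, eta tau = 0 makes this the integral of H^2, so H tau = 0. *)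
Section test_function.
Variables (tau b : R) (n : nat).
Hypotheses (tau0 : 0 < tau) (tauT : tau <= T) (b1 : b <= 1).

Let g t := prim c t - prim c tau.
Let pair_ (rho : R -> R -> R) t := \int[mu]_(x in `]0, 1[) (rho t x * step n b (x - g t)).
Let H := (fun t => pair_ rho1 t - pair_ rho2 t) \o clamp 0 tau.
Let eta t := prim H t - prim H tau.
Let phi (z : R * R) : R := step n b (z.2 - g z.1) * eta z.1.

Local Lemma g_cont : continuous g.
Proof. by move=> t; apply: cvgB; [exact: prim_continuous|exact: cvg_cst]. Qed.

Local Lemma H_cont : continuous H.
Proof.
have sub : `[0, tau]%classic `<=` (`[0, T]%classic : set R).
  by apply: subset_itvl; rewrite bnd_simp.
have h rho : in_C0L1 T rho -> {within `[0, tau], continuous pair_ rho}.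
  move=> rhoC; apply: (continuous_subspaceW sub).
  by apply: (pairing_continuous rhoC g_cont (@step_continuous _ n b) (step_bound n b)).
apply: continuous_clamp; first exact: ltW.
by move=> t; apply: cvgB; [exact: (h _ C1)|exact: (h _ C2)].
Qed.

Local Lemma H_left s : s <= 0 -> H s = H 0.
Proof. by move=> s0; rewrite /H /= !clamp_left// ltW. Qed.

Local Lemma eta_derive (t : R) : is_derive t 1 eta (H t).
Proof.
rewrite -[X in is_derive _ _ _ X]subr0; apply: is_deriveB.
by apply: is_derive_prim; [exact: H_cont|exact: H_left].
Qed.

Local Lemma eta_cont : continuous eta.
Proof. by move=> t; exact: is_derive_continuous (eta_derive t). Qed.

Local Lemma phi_partial_t (t x : R) :
  'D_(1, 0) phi (t, x) = - dstep n b (x - g t) * c t * eta t + step n b (x - g t) * H t.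
Proof.
rewrite derive_fst /phi/=.
have h1 : is_derive t 1 (fun s => x - g s) (- c t).
  rewrite -[X in is_derive _ _ _ X]add0r; apply: is_deriveB.
  by rewrite -[X in is_derive _ _ _ X]subr0; apply: is_deriveB; exact: rate_derive.
have h2 := is_derive1_comp (g := fun s => x - g s) (is_derive_step n b (x - g t)) h1.
have h3 := is_deriveM h2 (eta_derive t).
have [_ +] := h3; rewrite /= => ->.
by rewrite /GRing.scale/=; ring.
Qed.

Local Lemma phi_partial_x (t x : R) :
  'D_(0, 1) phi (t, x) = dstep n b (x - g t) * eta t.
Proof.
rewrite derive_snd /phi/=.
have h1 : is_derive x 1 (fun y => y - g t) 1.
  by rewrite -[X in is_derive _ _ _ X]subr0; apply: is_deriveB.
have h2 := is_derive1_comp (g := fun y => y - g t) (is_derive_step n b (x - g t)) h1.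
have h3 := is_deriveM h2 (is_derive_cst (eta t) x 1).
have [_ +] := h3; rewrite /= => ->.
by rewrite /GRing.scale/=; ring.
Qed.

Local Lemma phi_differentiable z : differentiable phi z.
Proof.
have dg : differentiable g z.1.
  apply/derivable1_diffP; apply: derivableB; last exact: derivable_cst.
  by have [h _] := rate_derive z.1 ec.
have deta : differentiable eta z.1 by apply/derivable1_diffP; have [h _] := eta_derive z.1.
have dst y : differentiable (step n b) y by apply/derivable1_diffP; have [h _] := is_derive_step n b y.
apply: differentiableM.
  apply: (@differentiable_comp _ _ _ _ (fun z : R * R => z.2 - g z.1) (step n b)); last exact: dst.
  apply: differentiableB; first exact: differentiable_snd.
  by apply: (@differentiable_comp _ _ _ _ fst g) => //; exact: differentiable_fst.
by apply: (@differentiable_comp _ _ _ _ fst eta) => //; exact: differentiable_fst.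
Qed.

Local Lemma phi_C1 : C1_rectangle tau phi.
Proof.
have cs (k : R -> R) : continuous k -> continuous (fun z : R * R => k (z.2 - g z.1)).
  move=> ck z; apply: (@continuous_comp _ _ _ (fun z : R * R => z.2 - g z.1) k); last exact: ck.
  apply: cvgB; first exact: cvg_snd.
  by apply: (@continuous_comp _ _ _ fst g); [exact: cvg_fst|exact: g_cont].
have ct (k : R -> R) : continuous k -> continuous (fun z : R * R => k z.1).
  by move=> ck z; apply: (@continuous_comp _ _ _ fst k); [exact: cvg_fst|exact: ck].
split.
- by apply: continuous_subspaceT => z; apply: differentiable_continuous; exact: phi_differentiable.
- by move=> z _; exact: phi_differentiable.
exists (fun z => - dstep n b (z.2 - g z.1) * c z.1 * eta z.1 + step n b (z.2 - g z.1) * H z.1).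
exists (fun z => dstep n b (z.2 - g z.1) * eta z.1); split.
- apply: continuous_subspaceT => z; apply: cvgD.
    apply: cvgM; last exact: (ct _ eta_cont).
    apply: cvgM; last by apply: ct; case: ec.
    by apply: cvgN; exact: (cs _ (@dstep_continuous _ n b)).
  by apply: cvgM; [exact: (cs _ (@step_continuous _ n b))|exact: (ct _ H_cont)].
- apply: continuous_subspaceT => z.
  by apply: cvgM; [exact: (cs _ (@dstep_continuous _ n b))|exact: (ct _ eta_cont)].
- by move=> [t x] _; rewrite phi_partial_t phi_partial_x.
Qed.

Local Lemma phi_weak rho : in_C0L1 T rho ->
  \int[mu]_(t in `]0, tau[) \int[mu]_(x in `]0, 1[)
     (rho t x * ('D_(1, 0) phi (t, x) + c t * 'D_(0, 1) phi (t, x))) =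
  \int[mu]_(t in `]0, tau[) (H t * (pair_ rho \o clamp 0 tau) t).
Proof.
move=> rhoC; apply: eq_Rintegral => t; rewrite mem_setE => tt.
have tt' : t \in `[0, tau] by exact: subset_itv_oo_cc tt.
have tT : t \in `[0, T].
  by move: tt'; rewrite !in_itv/= => /andP[-> h]; exact: le_trans tauT.
have ri : in_L1 0 1 (rho t) by case: rhoC => h _; exact: h.
have cst_ : continuous (fun x => step n b (x - g t)).
  move=> x; apply: (@continuous_comp _ _ _ (fun x : R => x - g t) (step n b)); last exact: step_continuous.
  by apply: cvgB; [exact: cvg_id|exact: cvg_cst].
have ii := pairing_int ri cst_ (fun y => step_bound n b _).
rewrite /= clamp_id// /pair_ -(@RintegralZl _ _ R mu _ _ _ (measurable_itv _) ii).
apply: eq_Rintegral => x _; rewrite phi_partial_t phi_partial_x; ring.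
Qed.

Local Lemma H_zero : H tau = 0.
Proof.
have cl (rho : R -> R -> R) : in_C0L1 T rho -> continuous (pair_ rho \o clamp 0 tau).
  move=> rhoC; apply: continuous_clamp; first exact: ltW.
  apply: (@continuous_subspaceW _ _ _ `[0, T]%classic).
    by apply: subset_itvl; rewrite bnd_simp.
  exact: (pairing_continuous rhoC g_cont (@step_continuous _ n b) (step_bound n b)).
have cHp (rho : R -> R -> R) : in_C0L1 T rho -> continuous (fun t => H t * (pair_ rho \o clamp 0 tau) t).
  by move=> rhoC t; apply: cvgM; [exact: H_cont|exact: cl].
have oo (f : R -> R) : continuous f -> mu.-integrable `]0, tau[ (EFin \o f).
  move=> cf; apply: (@integrableS _ _ R mu `[0, tau]%classic) => //; first exact: subset_itv_oo_cc.
  exact: continuous_integrable.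
pose f t := H t * H t.
have cf : continuous f by move=> t; apply: cvgM; exact: H_cont.
suff pf : prim f tau = 0.
  have : f tau = 0.
    apply: (prim_pos cf _ _ tau0 pf) => s; first by move=> s0; rewrite /f H_left.
    by rewrite /f -expr2 sqr_ge0.
  by move/eqP; rewrite /f mulf_eq0 orbb => /eqP.
rewrite prim_Rint//; last exact: ltW.
have := same tau0 tauT phi_C1 _ _; rewrite (phi_weak C1) (phi_weak C2) => E.
have {}E : \int[mu]_(t in `]0, tau[) (H t * (pair_ rho1 \o clamp 0 tau) t) =
    \int[mu]_(t in `]0, tau[) (H t * (pair_ rho2 \o clamp 0 tau) t).
  apply: E => [x _|t /[!in_itv]/= /andP[t0 tt]].
    by rewrite /phi /eta subrr mulr0.
  (* at x = 1 the argument 1 - g t is at least 1 >= b, since g <= 0 on [0, tau] *)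
  rewrite /phi /= step_right ?mul0r//.
  have pt : prim c t <= prim c tau by rewrite prim_mono.
  rewrite /g (le_trans b1)// lerBrDr gerDl subr_le0//.
rewrite -Rintegral_itv_bndo_bndc; last first.
  by apply: (@integrableS _ _ R mu `[0, tau]%classic) => //; [exact: subset_itv_co_cc|exact: continuous_integrable].
rewrite -Rintegral_itv_obnd_cbnd; last exact: oo.
have -> : f = (fun t => H t * (pair_ rho1 \o clamp 0 tau) t - H t * (pair_ rho2 \o clamp 0 tau) t).
  by apply/funext => t; rewrite -mulrBr.
rewrite (@RintegralB _ _ R mu _ _ _ (measurable_itv _) (oo _ (cHp _ C1)) (oo _ (cHp _ C2))).
by rewrite E subrr.
Qed.

Lemma test_step : \int[mu]_(x in `]0, 1[) ((rho1 tau x - rho2 tau x) * step n b x) = 0.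
Proof.
have tT : tau \in `[0, T] by rewrite in_itv/= ltW.
have ri rho : in_C0L1 T rho -> in_L1 0 1 (rho tau) by case=> h _; exact: h.
have ii rho (rhoC : in_C0L1 T rho) := pairing_int (ri _ rhoC) (@step_continuous _ n b) (step_bound n b).
have := H_zero; rewrite /H /= clamp_id; last by rewrite in_itv/= lexx ltW.
rewrite /pair_ /g subrr; under eq_Rintegral do rewrite subr0.
under [X in _ - X]eq_Rintegral do rewrite subr0.
rewrite -(@RintegralB _ _ R mu _ _ _ (measurable_itv _) (ii _ C1) (ii _ C2)) => E.
by rewrite -[RHS]E; apply: eq_Rintegral => x _; rewrite mulrBl.
Qed.

End test_function.

(** For t > 0 the two functions have the same pairings with all steps; t = 0
follows by continuity in L^1. *)
Lemma linear_uniq : eq_C0L1 T rho1 rho2.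
Proof.
have mI : measurable (`]0, 1[%classic : set R) by [].
have [i1 c1] := C1; have [i2 c2] := C2.
have pos t : 0 < t -> t <= T -> {ae mu, forall x, x \in `]0, 1[ -> rho1 t x = rho2 t x}.
  move=> t0 tT; have tI : t \in `[0, T] by rewrite in_itv/= ltW.
  have : {ae mu, forall x, x \in `]0, 1[ -> rho1 t x - rho2 t x = 0}.
    apply: (@vanish_ae (fun x => rho1 t x - rho2 t x)).
      by apply: integrable_sub => //; [exact: i1|exact: i2].
    by move=> n b b1; exact: test_step.
  apply: filterS; first exact: (ae_filter_ringOfSetsType mu).
  by move=> x h x01; apply/eqP; rewrite -subr_eq0; apply/eqP; exact: h.
move=> t; rewrite in_itv/= => /andP[t0 tT].
move: t0; rewrite le_eqVlt => /predU1P[<-|t0]; last exact: pos.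
have I0 : 0 \in `[0, T] by rewrite in_itv/= lexx ltW.
pose N (f g : R -> R) := \int[mu]_(x in `]0, 1[) `|f x - g x|.
have iN s : s \in `[0, T] -> forall s', s' \in `[0, T] -> forall f g, 
  (f = rho1 \/ f = rho2) -> (g = rho1 \/ g = rho2) ->
  mu.-integrable `]0, 1[ (EFin \o (fun x => `|f s x - g s' x|)).
  move=> sT s' sT' f g [->|->] [->|->]; apply: (@integrable_norm _ _ R mu);
  by apply: integrable_sub => //; (exact: i1 || exact: i2).
have N0 : N (rho1 0) (rho2 0) = 0.
  apply/eqP; rewrite eq_le; apply/andP; split; last exact: Rintegral_ge0.
  apply/ler_addgt0Pr => e e0; rewrite add0r.
  have e2 : 0 < e / 2 by rewrite divr_gt0.
  have near_small (f : R -> R -> R) : 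
     \int[mu]_(x in `]0, 1[) `|f s x - f 0 x| @[s --> within `[0, T] (nbhs 0)] --> (0 : R) ->
     exists2 d, 0 < d & forall s, 0 < s -> s < d -> s <= T -> N (f s) (f 0) <= e / 2.
    move/cvgrPdist_le => /(_ _ e2)[d /= d0 hd]; exists d => // s s0 sd sT.
    have := hd s; rewrite /= sub0r normrN gtr0_norm// => /(_ sd).
    rewrite in_itv/= (ltW s0) sT => /(_ isT); rewrite sub0r normrN.
    by apply: le_trans; exact: ler_norm.
  have [d1 d10 h1] := near_small rho1 (c1 0 I0).
  have [d2 d20 h2] := near_small rho2 (c2 0 I0).
  pose s := Num.min T (Num.min (d1 / 2) (d2 / 2)).
  have s0 : 0 < s by rewrite !lt_min T0 !divr_gt0.
  have sT : s <= T by rewrite ge_min lexx.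
  have sd1 : s < d1.
    have : s <= d1 / 2 by rewrite !ge_min lexx orbT.
    lra.
  have sd2 : s < d2.
    have : s <= d2 / 2 by rewrite !ge_min lexx !orbT.
    lra.
  have sI : s \in `[0, T] by rewrite in_itv/= ltW.
  have := h1 s s0 sd1 sT; have := h2 s s0 sd2 sT.
  have Nle : N (rho1 0) (rho2 0) <= N (rho1 s) (rho1 0) + N (rho2 s) (rho2 0).
    have J1 := iN _ sI _ I0 _ _ (or_introl erefl) (or_introl erefl).
    have J2 := iN _ sI _ I0 _ _ (or_intror erefl) (or_intror erefl).
    have J3 := iN _ sI _ sI _ _ (or_introl erefl) (or_intror erefl).
    have Ns : N (rho1 s) (rho2 s) = 0.
      rewrite -[RHS](Rintegral_zero mI); apply: Rintegral_ae => //.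
        by apply/measurable_EFinP; case/integrableP: J3.
      have := pos s s0 sT; apply: filterS; first exact: (ae_filter_ringOfSetsType mu).
      by move=> x h x01; rewrite h// subrr normr0.
    rewrite -[leRHS]addr0 -[X in _ <= _ + X]Ns /N.
    have J12 := integrable_add mI J1 J2.
    rewrite -(@RintegralD _ _ R mu _ _ _ mI J1 J2) -(@RintegralD _ _ R mu _ _ _ mI J12 J3).
    apply: le_Rintegral => //.
    - exact: (iN _ I0 _ I0 _ _ (or_introl erefl) (or_intror erefl)).
    - exact: integrable_add.
    move=> x _.
    have -> : rho1 0 x - rho2 0 x = - (rho1 s x - rho1 0 x) + (rho2 s x - rho2 0 x) + (rho1 s x - rho2 s x) by lra.
    rewrite (le_trans (ler_normD _ _))// lerD2r (le_trans (ler_normD _ _))//.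
    by rewrite normrN.
  lra.
have i0 := iN _ I0 _ I0 _ _ (or_introl erefl) (or_intror erefl).
have idf : mu.-integrable `]0, 1[ (EFin \o (fun x => rho1 0 x - rho2 0 x)).
  by apply: integrable_sub => //; [exact: i1|exact: i2].
have : (\int[mu]_(x in `]0%R, 1%R[) `|(EFin \o (fun x => rho1 0 x - rho2 0 x)%R) x| = 0)%E.
  rewrite -[LHS]fineK; first by congr EFin.
  exact: (@integrable_fin_num _ _ R mu _ mI _ i0).
move/(@ae_eq_integral_abs _ _ R mu _ mI _ (@measurable_int _ _ R mu _ _ idf)).
move=> E; apply: (@filterS _ (almost_everywhere mu) (ae_filter_ringOfSetsType mu) _ _ _ E).
by move=> x h x01; have [/eqP] := h x01; rewrite subr_eq0 => /eqP.
Qed.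

End linear_uniqueness.

(** * Nonlinear equation: existence and uniqueness *)

Section assembly.
Context {R : realType}.
Notation mu := (@lebesgue_measure R).

Lemma clamp_lipschitz (a b x y : R) : `|clamp a b x - clamp a b y| <= `|x - y|.
Proof.
wlog xy : x y / x <= y => [h|].
  by have [/h//|/ltW/h] := leP x y; rewrite distrC [leRHS]distrC.
have h1 : clamp a b x <= clamp a b y by rewrite /clamp le_max2// le_min2.
rewrite distrC [leRHS]distrC !ger0_norm ?subr_ge0//.
rewrite /clamp; case: (leP x b) => xb; case: (leP y b) => yb;
  rewrite /Order.max; do ![case: ifPn => ?]; lra.
Qed.

(** A C^1 function on a compact interval is bounded, bounded below and Lipschitz;
clamping its argument makes these bounds global. *)
Lemma truncated_speed (lam : R -> R) (B : R) : C1_positive lam -> 0 <= B ->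
  exists m M L : R, [/\ 0 < m, 0 <= L,
    (forall w, m <= (lam \o clamp (- B) B) w <= M),
    (forall w w', `|(lam \o clamp (- B) B) w - (lam \o clamp (- B) B) w'| <= L * `|w - w'|) &
    continuous (lam \o clamp (- B) B)].
Proof.
move=> [dlam cdlam lam0] B0.
have BB : - B <= B by lra.
have dl (w : R) : is_derive w 1 lam (derive1 lam w) by rewrite derive1E; apply: derivableP; exact: dlam.
have clam : continuous lam by move=> w; exact: is_derive_continuous (dl w).
have [w1 _ h1] := EVT_min BB (continuous_subspaceT clam).
have [w2 _ h2] := EVT_max BB (continuous_subspaceT clam).
have [L hL] := continuous_bounded_itv (- B) B cdlam.
have cB w : clamp (- B) B w \in `[- B, B] by exact: clamp_itv.
exists (lam w1), (lam w2), (Num.max 0 L); split.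
- exact: lam0.
- by rewrite le_max lexx.
- by move=> w; rewrite h1//= h2.
- have lip x y : x \in `[- B, B] -> y \in `[- B, B] -> x <= y ->
      `|lam y - lam x| <= Num.max 0 L * `|y - x|.
    move=> xB yB xy; have [z zxy ->] := MVT_segment xy (fun z _ => dl z) (continuous_subspaceT clam).
    rewrite normrM ler_wpM2r// le_max hL ?orbT//.
    move: xB yB zxy; rewrite !in_itv/= => /andP[x1 _] /andP[_ y1] /andP[z1 z2].
    by rewrite (le_trans x1)// (le_trans z2).
  move=> w w'; apply: (@le_trans _ _ (Num.max 0 L * `|clamp (- B) B w - clamp (- B) B w'|)).
    have [h|/ltW h] := leP (clamp (- B) B w) (clamp (- B) B w').
      by rewrite /= distrC [in leRHS]distrC; apply: lip.
    by apply: lip.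
  by rewrite ler_wpM2l ?clamp_lipschitz// le_max lexx.
- by move=> w; apply: continuous_comp; [exact: clamp_continuous|exact: clam].
Qed.

(** A representative of nonnegative L^1(a, b) data that is nonnegative everywhere
and zero outside, so that it can be integrated over the line. *)
Definition truncation (a b : R) (f : R -> R) : R -> R :=
  (fun x => Num.max 0 (f x)) \_ `]a, b[.

Lemma truncation_ge0 a b f x : 0 <= truncation a b f x.
Proof. by rewrite /truncation patchE; case: ifP => // _; rewrite le_max lexx. Qed.

Lemma truncation_out a b f x : x \notin `]a, b[ -> truncation a b f x = 0.
Proof. by move=> h; rewrite /truncation patchE mem_setE (negbTE h). Qed.

Lemma truncation_int a b f : in_L1 a b f -> mu.-integrable [set: R] (EFin \o truncation a b f).
Proof.
move=> fi; rewrite -restrict_EFin.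
apply/(@integrable_mkcond _ _ R mu _ _ (measurable_itv _)).
have mf : measurable_fun (`]a, b[%classic : set R) f by apply/measurable_EFinP; case/integrableP: fi.
apply: (dominated_integrable1 (measurable_itv _) _ (@integrable_norm _ _ R mu _ _ fi)).
  by apply: measurable_maxr => //; exact: measurable_cst.
move=> x _ /=; rewrite ger0_norm ?le_max ?lexx//.
by rewrite ge_max normr_ge0 ler_norm.
Qed.

Lemma truncation_Rintegral a b (c d : R) f g : in_L1 a b f -> ae_nonneg a b f ->
  `]c, d[%classic `<=` (`]a, b[%classic : set R) -> measurable_fun (`]c, d[%classic : set R) g ->
  \int[mu]_(x in `]c, d[) (f x * g x) = \int[mu]_(x in `]c, d[) (truncation a b f x * g x).
Proof.
move=> fi f0 sub mg.
have mf : measurable_fun (`]a, b[%classic : set R) f by apply/measurable_EFinP; case/integrableP: fi.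
have mt : measurable_fun [set: R] (truncation a b f).
  by apply/measurable_EFinP; case/integrableP: (truncation_int fi).
apply: Rintegral_ae => //.
- by apply: measurable_funM => //; apply: measurable_funS mf.
- by apply: measurable_funM => //; apply: measurable_funTS.
move: f0; apply: filterS; first exact: (ae_filter_ringOfSetsType mu).
move=> x h /sub/= xab; congr (_ * _).
by rewrite /truncation patchE mem_setE xab max_r// h.
Qed.

Lemma test_measurable0 tau (phi : R * R -> R) : 0 < tau -> C1_rectangle tau phi ->
  measurable_fun (`]0, tau[%classic : set R) (fun t => phi (t, 0)) /\
  measurable_fun (`]0, 1[%classic : set R) (fun x => phi (0, x)).
Proof.
move=> tau0 [cphi _ _].
have cc := continuous_clamp2 (ltW tau0) cphi.
split.
  apply: (@eq_measurable_fun _ _ _ _ _ (fun t => (phi \o clamp2 tau) (t, 0))).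
    move=> t; rewrite mem_setE => tt; rewrite /= clamp2_id//; split; rewrite /=.
      exact: subset_itv_oo_cc tt.
    by rewrite in_itv/= lexx ler01.
  apply: measurable_funTS; apply: continuous_measurable_fun => x.
  apply: (@continuous_comp _ _ _ (fun x : R => (x, 0 : R)) (phi \o clamp2 tau)); last exact: cc.
  by apply: continuous_pair => s; [exact: cvg_id|exact: cvg_cst].
apply: (@eq_measurable_fun _ _ _ _ _ (fun x => (phi \o clamp2 tau) (0, x))).
  move=> t; rewrite mem_setE => tt; rewrite /= clamp2_id//; split; rewrite /=.
    by rewrite in_itv/= lexx ltW.
  exact: subset_itv_oo_cc tt.
apply: measurable_funTS; apply: continuous_measurable_fun => x.
apply: (@continuous_comp _ _ _ (fun x : R => (0 : R, x)) (phi \o clamp2 tau)); last exact: cc.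
by apply: continuous_pair => s; [exact: cvg_cst|exact: cvg_id].
Qed.

Lemma mass_continuous T (rho : R -> R -> R) : in_C0L1 T rho ->
  {within `[0, T], continuous (total_mass rho)}.
Proof.
move=> rhoC.
have h := @pairing_continuous _ T rho rhoC (cst 0) (cst 1) 1 (@cst_continuous _ _ _) (@cst_continuous _ _ _) _.
have -> : total_mass rho = (fun t => \int[mu]_(x in `]0, 1[) (rho t x * cst 1 (x - cst 0 t))).
  by apply/funext => t; apply: eq_Rintegral => x _; rewrite /= mulr1.
by apply: h => y; rewrite normr1.
Qed.

Variables (T : R) (lam rho0 u : R -> R).
Hypotheses (T0 : 0 < T) (hlam : C1_positive lam)
  (hrho0 : in_L1 0 1 rho0) (hu : in_L1 0 T u)
  (hrho0_ge0 : ae_nonneg 0 1 rho0) (hu_ge0 : ae_nonneg 0 T u).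

Let r := truncation 0 1 rho0.
Let v := truncation 0 T u.
Let N := cdf (fun z => r (- z)).
Let U := cdf v.
(** B is the mass entering during [0, T] together with the initial mass. All
masses of transported densities lie in [- B, B], so replacing lam by its
truncation l goes unnoticed. *)
Let B := N 0 + U T.
Let l := lam \o clamp (- B) B.

Local Lemma r_int : mu.-integrable [set: R] (EFin \o r). Proof. exact: truncation_int. Qed.
Local Lemma v_int : mu.-integrable [set: R] (EFin \o v). Proof. exact: truncation_int. Qed.
Local Lemma r_ge0 x : 0 <= r x. Proof. exact: truncation_ge0. Qed.
Local Lemma v_ge0 x : 0 <= v x. Proof. exact: truncation_ge0. Qed.
Local Lemma r_out x : x \notin `]0, 1[ -> r x = 0. Proof. exact: truncation_out. Qed.
Local Lemma v_out x : x \notin `]0, T[ -> v x = 0. Proof. exact: truncation_out. Qed.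

Local Lemma N_cont : continuous N. Proof. exact: (cdf_continuous (rN_int r_int)). Qed.
Local Lemma U_cont : continuous U. Proof. exact: (cdf_continuous v_int). Qed.
Local Lemma N_mono : {homo N : x y / x <= y}.
Proof. by apply: (cdf_mono (rN_int r_int)) => x; exact: r_ge0. Qed.
Local Lemma U_mono : {homo U : x y / x <= y}.
Proof. by apply: (cdf_mono v_int) => x; exact: v_ge0. Qed.
Local Lemma N_left z : z <= -1 -> N z = 0.
Proof.
apply: cdf_left => x x1; apply: r_out.
by rewrite in_itv/= negb_and -!leNgt; apply/orP; right; lra.
Qed.
Local Lemma N_right z : 0 <= z -> N z = N 0.
Proof.
apply: (cdf_right (rN_int r_int)) => x x1; apply: r_out.
by rewrite in_itv/= negb_and -!leNgt; apply/orP; left; lra.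
Qed.
Local Lemma U_left t : t <= 0 -> U t = 0.
Proof.
apply: cdf_left => x x1; apply: v_out.
by rewrite in_itv/= negb_and -!leNgt x1.
Qed.
Local Lemma U_right t : T <= t -> U t = U T.
Proof.
apply: (cdf_right v_int) => x x1; apply: v_out.
by rewrite in_itv/= negb_and -!leNgt x1 orbT.
Qed.

Local Lemma mass_lam c t : positive_rate c ->
  l (entered N U t - delayed N U c (prim c t)) = lam (entered N U t - delayed N U c (prim c t)).
Proof.
move=> ec; rewrite /l /= clamp_id// in_itv/=.
have /andP[h1 h2] := entered_bounds N_mono N_left U_mono U_left U_right t.
have /andP[h3 h4] := mass_upto_bounds N_mono N_left N_right U_mono U_left U_right c (prim c t - 1).
by rewrite /delayed /B; apply/andP; split; lra.
Qed.

Local Lemma B_ge0 : 0 <= B.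
Proof.
have /andP[h1 h2] := entered_bounds N_mono N_left U_mono U_left U_right 0.
exact: le_trans h2.
Qed.

Local Lemma mass_transported c t : positive_rate c -> 0 <= t ->
  lam (total_mass (transported r v c) t) = l (entered N U t - delayed N U c (prim c t)).
Proof.
by move=> ec t0; rewrite mass_lam// (transported_mass r_int r_ge0 r_out v_int v_ge0).
Qed.

Lemma data_terms tau phi : 0 < tau -> tau <= T -> C1_rectangle tau phi ->
  \int[mu]_(t in `]0, tau[) (u t * phi (t, 0)) = \int[mu]_(t in `]0, tau[) (v t * phi (t, 0)) /\
  \int[mu]_(x in `]0, 1[) (rho0 x * phi (0, x)) = \int[mu]_(x in `]0, 1[) (r x * phi (0, x)).
Proof.
move=> tau0 tauT hphi; have [m1 m2] := test_measurable0 tau0 hphi.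
split; apply: truncation_Rintegral => //.
by apply: subset_itvl; rewrite bnd_simp.
Qed.

Lemma transported_solution c : positive_rate c -> self_consistent T l N U c ->
  weak_solution T lam rho0 u (transported r v c).
Proof.
move=> ec sc; split; first exact: (transported_C0L1 r_int r_ge0 v_int v_ge0).
move=> tau phi; rewrite in_itv/= => /andP[tau0 tauT] hphi phi1 phi2.
(* for tau = 0 the test function vanishes at the initial time *)
move: tau0; rewrite le_eqVlt => /predU1P[tauE|tau0].
  rewrite -tauE set_itvoo0 !Rintegral_set0 !add0r -[RHS](Rintegral_zero (measurable_itv `]0, 1[)).
  apply: eq_Rintegral => x; rewrite mem_setE => x01.
  by rewrite tauE phi1 ?mulr0//; exact: subset_itv_oo_cc x01.
have [-> ->] := data_terms tau0 tauT hphi.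
have [cphi dphi [phit [phix [cphit cphix Dphi]]]] := hphi.
have E : \int[mu]_(t in `]0, tau[) \int[mu]_(x in `]0, 1[)
     (transported r v c t x * ('D_(1, 0) phi (t, x)
        + lam (total_mass (transported r v c) t) * 'D_(0, 1) phi (t, x))) =
   \int[mu]_(t in `]0, tau[) \int[mu]_(x in `]0, 1[)
     (transported r v c t x * ('D_(1, 0) phi (t, x) + c t * 'D_(0, 1) phi (t, x))).
  apply: eq_Rintegral => t; rewrite mem_setE in_itv/= => /andP[t0 tt].
  apply: eq_Rintegral => x _; rewrite mass_transported ?ltW//.
  by rewrite -sc// in_itv/= !ltW// (lt_le_trans tt).
by rewrite E; exact: (transported_weak r_int r_ge0 r_out v_int v_ge0 v_out ec tau0 cphi dphi cphit cphix Dphi phi1 phi2).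
Qed.

(** Reading lam (W t) as a prescribed speed c makes the equation linear, and
linear uniqueness identifies rho with the transported density of c; its mass
formula then says that c is self-consistent. Clamping time extends c beyond
[0, T]. *)
Lemma weak_solution_transported rho : weak_solution T lam rho0 u rho ->
  exists c, [/\ positive_rate c, forall t, c t = c (clamp 0 T t), self_consistent T l N U c &
    eq_C0L1 T rho (transported r v c)].
Proof.
move=> [rhoC rhoW].
have [dlam _ lam0] := hlam.
have clam : continuous lam.
  by move=> w; apply/differentiable_continuous/derivable1_diffP; exact: dlam.
pose W := total_mass rho \o clamp 0 T.
have cW : continuous W by apply: continuous_clamp; [exact: ltW|exact: mass_continuous].
pose c t := lam (W t).
have cc : continuous c by move=> t; apply: continuous_comp; [exact: cW|exact: clam].
have cE t : c t = c (clamp 0 T t).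
  by rewrite /c /W /= [clamp 0 T (clamp 0 T t)]clamp_id// clamp_itv// ltW.
have [t1 _ ht1] := EVT_min (ltW T0) (continuous_subspaceT cc).
have ec : positive_rate c.
  split => //.
    exists (c t1); first exact: lam0.
    by move=> t; rewrite (cE t) ht1// clamp_itv// ltW.
  by move=> t t0; rewrite (cE t) (cE 0) !clamp_left// ltW.
have E : eq_C0L1 T rho (transported r v c).
  apply: (linear_uniq T0 ec rhoC (transported_C0L1 r_int r_ge0 v_int v_ge0 T ec)).
  move=> tau phi tau0 tauT hphi phi1 phi2.
  have tI : tau \in `[0, T] by rewrite in_itv/= ltW.
  have := rhoW tau phi tI hphi phi1 phi2.
  have [-> ->] := data_terms tau0 tauT hphi.
  have [cphi dphi [phit [phix [cphit cphix Dphi]]]] := hphi.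
  rewrite -[X in _ = X -> _](transported_weak r_int r_ge0 r_out v_int v_ge0 v_out ec tau0 cphi dphi cphit cphix Dphi phi1 phi2).
  move=> /addIr/addIr <-; apply: eq_Rintegral => t; rewrite mem_setE in_itv/= => /andP[t0 tt].
  apply: eq_Rintegral => x _; rewrite /c /W /= clamp_id// in_itv/= ltW//=.
  by rewrite ltW// (lt_le_trans tt).
exists c; split => // t tT.
have t0 : 0 <= t by move: tT; rewrite in_itv/= => /andP[].
rewrite -mass_transported// /c /W /= clamp_id//; congr lam.
have mI : measurable (`]0, 1[%classic : set R) by [].
have mm (f : R -> R -> R) : in_C0L1 T f -> measurable_fun (`]0, 1[%classic : set R) (f t).
  by case=> h _; apply/measurable_EFinP; case/integrableP: (h t tT).
apply: Rintegral_ae => //; [exact: mm|by apply: mm; exact: (transported_C0L1 r_int r_ge0 v_int v_ge0)|].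
exact: (E t tT).
Qed.

Lemma well_posed : exists rho : R -> R -> R,
    [/\ weak_solution T lam rho0 u rho,
        forall rho', weak_solution T lam rho0 u rho' -> eq_C0L1 T rho' rho
      & ae_nonneg_on_Q T rho].
Proof.
have [m [M [L [m0 L0 lmM lL cl]]]] := truncated_speed hlam B_ge0.
have ml w : m <= l w by case/andP: (lmM w).
have lM w : l w <= M by case/andP: (lmM w).
have [c [cc cmM cE sc]] := self_consistent_exists T0 m0 L0 ml lM lL cl N_cont N_mono
  N_left N_right U_cont U_mono U_left U_right.
have ec : positive_rate c.
  split => //; first by exists m => // t; case/andP: (cmM t).
  by move=> t t0; rewrite (cE t) (cE 0) !clamp_left// ltW.
exists (transported r v c); split.
- exact: transported_solution.
(* both speeds factor through clamp 0 T: agreement on [0, T] is equality *)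
- move=> rho' /weak_solution_transported[c' [ec' cE' sc' E]].
  suff -> : c = c' by [].
  apply/funext => t; rewrite (cE t) (cE' t).
  apply: (self_consistent_uniq m0 L0 ml lL N_cont N_mono N_left N_right U_cont U_mono U_left U_right) => //.
  by apply: clamp_itv; exact: ltW.
split.
  apply: measurable_funTS; exact: (transported_measurable r_int v_int ec).
by apply: aeW => z _; exact: (transported_ge0 r_ge0 v_ge0).
Qed.

End assembly.

Theorem theorem2p3 (R : realType) (T : R) (lam rho0 u : R -> R)
    (hT : 0 < T) (hlam : C1_positive lam)
    (hrho0 : in_L1 0 1 rho0) (hu : in_L1 0 T u)
    (hrho0_ge0 : ae_nonneg 0 1 rho0) (hu_ge0 : ae_nonneg 0 T u) :
  exists rho : R -> R -> R,
    [/\ weak_solution T lam rho0 u rho,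
        forall rho', weak_solution T lam rho0 u rho' -> eq_C0L1 T rho' rho
      & ae_nonneg_on_Q T rho].
Proof. exact: well_posed. Qed.
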